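(* Let $k_0=k_0(n)=\log_2 n-2\log_2\log_2 n$, and let $k=k(n)$ be integers with $1\le k\le n-1$. Then the following hold. (1) If $k\le\lfloor k_0\rfloor$ (for all sufficiently large $n$), then w.h.p. $Q^n(k)$ is disconnected. (2) If $k\ge\lceil k_0\rceil+1$ (for all sufficiently large $n$), then w.h.p. $Q^n(k)$ is $k$-connected.
   Context: $Q^n$ is the $n$-dimensional cube: the graph with vertex set $V=\{0,1\}^n$ in which two vertices are adjacent iff they differ in precisely one coordinate. For an integer $1\le k\le n-1$, $Q^n(k)$ (the $k$-out model) is the random (simple, undirected) spanning subgraph of $Q^n$ with vertex set $V$ obtained as follows: independently for every $v\in V$, choose a set of $k$ distinct edges uniformly from all the $\binom{n}{k}$ sets of $k$ distinct edges of $Q^n$ incident to $v$; the edge set of $Q^n(k)$ is the union of all chosen sets. A graph is $\ell$-connected if it has more than $\ell$ vertices and remains connected whenever fewer than $\ell$ vertices are removed. A sequence of events holds with high probability (w.h.p.) if its probability tends to $1$ as $n\to\infty$; $k$ is allowed to depend on $n$. *)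

(* Defs.v *)
From HB Require Import structures.
From mathcomp Require Import all_boot all_order all_algebra.
From mathcomp Require Import all_classical all_reals all_analysis.
Set Implicit Arguments.
Unset Strict Implicit.
Unset Printing Implicit Defensive.
Import Order.TTheory GRing.Theory Num.Theory.
Import numFieldNormedType.Exports.
Local Open Scope ring_scope.

(* A graph on a finite vertex type T is given by its set of edges, an edge
   being an unordered pair of vertices, i.e. a two-element set of vertices. *)

Definition gadj (T : finType) (E : {set {set T}}) : rel T :=
  [rel u v | (u != v) && ([set u; v] \in E)].

(* Connectedness of the subgraph induced on S. *)
Definition connected_on (T : finType) (E : {set {set T}}) (S : {set T}) : bool :=
  [forall x in S, forall y in S,
     connect [rel u v | [&& u \in S, v \in S & gadj E u v]] x y].

Definition gconnected (T : finType) (E : {set {set T}}) : bool :=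
  connected_on E [set: T].

Definition kconnected (T : finType) (E : {set {set T}}) (l : nat) : bool :=
  (l < #|T|)%N && [forall X : {set T}, (#|X| < l)%N ==> connected_on E (~: X)].

Definition cube (n : nat) : finType := {ffun 'I_n -> bool}.

Definition cube_adj (n : nat) : rel (cube n) :=
  [rel u v : cube n | #|[set i : 'I_n | u i != v i]| == 1%N].

Definition cube_edges (n : nat) : {set {set cube n}} :=
  [set [set p.1; p.2] | p : cube n * cube n & cube_adj p.1 p.2].

Definition incident_edges (n : nat) (v : cube n) : {set {set cube n}} :=
  [set e in cube_edges n | v \in e].

(* A choice function c assigns to each vertex v a set c v of edges.  Its
   probability is the product over v of the uniform mass, 1 / 'C(n, k) on the
   k-subsets of the edges at v, by independence of the choices. *)
Definition kout_mass (R : realType) (n k : nat)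
    (c : {ffun cube n -> {set {set cube n}}}) : R :=
  \prod_(v : cube n)
    (if (c v \subset incident_edges v) && (#|c v| == k)
     then ('C(n, k)%:R)^-1 else 0).

Definition kout_edges (n : nat) (c : {ffun cube n -> {set {set cube n}}}) :
    {set {set cube n}} :=
  (\bigcup_(v : cube n) c v)%SET.

Definition kout_prob (R : realType) (n k : nat)
    (A : pred {set {set cube n}}) : R :=
  \sum_(c : {ffun cube n -> {set {set cube n}}} | A (kout_edges c))
    kout_mass R k c.
Arguments kout_prob R n k A : clear implicits.

Definition whp (R : realType) (p : nat -> R) : Prop :=
  (p @ \oo --> (1 : R))%classic.

Definition log2 (R : realType) (x : R) : R := ln x / ln 2.

Definition k0 (R : realType) (n : nat) : R :=
  log2 n%:R - 2 * log2 (log2 n%:R).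

(* Main.v *)
(* Record the choice of a vertex as a set of directions, so that a configuration
   is a point of a product probability space.

   (1) If 2^k (log2 n)^2 <= n, a given subcube of dimension k is a component,
   each of its vertices choosing exactly its k inner edges and no outer
   neighbour choosing an edge to it, with probability at least
   (4n)^(-k 2^k) >= 2^(-n + n log2 (log2 n) / log2 n).  Such events are
   independent for subcubes that are not close, so by the second moment method
   one of the 2^(n-k) parallel subcubes is isolated w.h.p.

   (2) Suppose 2^(k-1) (log2 n)^2 >= n.  If G is not k-connected, there are X with
   |X| < k and a component S of G - X with |S| <= 2^(n-1).
   Small S, |S| <= 2^(n/32): all choices made in S stay in W = S + X.  By the
   edge-isoperimetric inequality the degrees of W have sum <= |W| log2 |W|, so
   AM-GM bounds the probability by (|W| log2 |W| / (|S| n))^(k|S|).  The same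
   inequality forces |S| >= (3/4) 2^k >= (3/2) n / (log2 n)^2, which beats the
   number 2^n n^(2|S|) of connected sets S and the number of X.
   Large S: reveal k-1 choices of each vertex first.  The first moment method shows
   that few vertices lie in components of size <= n^4 at this stage, so there
   are few unions S of components; S sends at least |S| - nk cube edges to
   the rest, and the last choices avoid all of them with probability at most
   exp(-(|S| - nk) / n^2), which beats the number of pairs (X, S). *)

Require Import Defs.
From HB Require Import structures.
From mathcomp Require Import all_boot all_order all_algebra.
From mathcomp Require Import all_classical all_reals all_analysis.
From mathcomp Require Import ring lra zify.
(* [all_classical] shadows the names of the finite set lemmas. *)
From mathcomp Require Import fintype finset.
Set Implicit Arguments.
Unset Strict Implicit.
Unset Printing Implicit Defensive.
Import Order.TTheory GRing.Theory Num.Theory.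
Import numFieldNormedType.Exports.
Local Open Scope ring_scope.

(** * Product measures *)

Section ProductMeasure.
Variables (R : realType) (I W : finType).
Implicit Types (mu : I -> W -> R) (A B : pred {ffun I -> W}).

Definition Pr mu A : R := \sum_(c | A c) \prod_i mu i (c i).

Lemma Pr_ge0 mu A : (forall i w, 0 <= mu i w) -> 0 <= Pr mu A.
Proof. by move=> h; apply: sumr_ge0 => c _; apply: prodr_ge0 => i _. Qed.

Lemma PrE mu A : Pr mu A = \sum_c (A c)%:R * \prod_i mu i (c i).
Proof.
rewrite /Pr big_mkcond; apply: eq_bigr => c _.
by case: (A c); rewrite ?mul1r ?mul0r.
Qed.

Lemma le_Pr mu A B : (forall i w, 0 <= mu i w) ->
  (forall c : {ffun I -> W}, (forall i, mu i (c i) != 0) -> A c -> B c) -> Pr mu A <= Pr mu B.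
Proof.
move=> h AB; rewrite !PrE; apply: ler_sum => c _.
have p0 : 0 <= \prod_i mu i (c i) by apply: prodr_ge0 => i _.
have [/forallP s|/forallPn[i]] := boolP [forall i, mu i (c i) != 0].
  by case Ac : (A c); rewrite ?mul0r ?mul1r ?(AB c s Ac) ?mul1r ?mulr_ge0.
by rewrite negbK => /eqP e; rewrite (bigD1 i)//= e !mul0r !mulr0.
Qed.

(** Independence of the coordinates, obtained by distributing the product over the sums. *)
Lemma Pr_forall mu (F : I -> pred W) :
  Pr mu (fun c => [forall i, F i (c i)]) = \prod_i \sum_(w | F i w) mu i w.
Proof.
under [RHS]eq_bigr do rewrite big_mkcond.
rewrite bigA_distr_bigA /Pr big_mkcond; apply: eq_bigr => c _.
case: ifPn => [/forallP h|/forallPn[i hi]].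
  by apply: eq_bigr => i _; rewrite h.
by rewrite (bigD1 i)//= (negbTE hi) mul0r.
Qed.

Lemma Pr_predT mu : (forall i, \sum_w mu i w = 1) -> Pr mu predT = 1.
Proof.
move=> h; transitivity (\prod_(i : I) \sum_w mu i w).
  by rewrite bigA_distr_bigA.
by apply: big1 => i _.
Qed.

Lemma Pr_union mu (T : finType) (Q : pred T) A (B : T -> pred {ffun I -> W}) :
  (forall i w, 0 <= mu i w) ->
  (forall c, A c -> exists2 t, Q t & B t c) ->
  Pr mu A <= \sum_(t | Q t) Pr mu (B t).
Proof.
move=> h AB; rewrite PrE; under [leRHS]eq_bigr do rewrite PrE.
rewrite exchange_big /=; apply: ler_sum => c _; rewrite -mulr_suml.
apply: ler_wpM2r; first by apply: prodr_ge0 => i _.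
case Ac : (A c); last by apply: sumr_ge0 => t _; rewrite ler0n.
have [t Qt Bt] := AB c Ac.
by rewrite (bigD1 t)//= Bt lerDl; apply: sumr_ge0 => u _; rewrite ler0n.
Qed.

Lemma PrC mu A : (forall i, \sum_w mu i w = 1) ->
  Pr mu (fun c => ~~ A c) = 1 - Pr mu A.
Proof.
move=> /Pr_predT <-; rewrite /Pr (bigID A predT) /=; ring.
Qed.

(** Chebyshev's inequality for the number [X] of events [B t] that occur. Far pairs contribute at
    most [m ^+ 2] to the second moment; each [t] has at most [c] near partners, each contributing at
    most [Pr mu (B t)]. So the variance is at most [c * m], while [m] is at least [#|T| * p]. *)
Lemma second_moment mu (T : finType) (B : T -> pred {ffun I -> W})
    (far : rel T) (p : R) (c : nat) :
  (forall i w, 0 <= mu i w) -> (forall i, \sum_w mu i w = 1) ->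
  0 < p -> (0 < #|T|)%N ->
  (forall t, p <= Pr mu (B t)) ->
  (forall t u, far t u ->
     Pr mu (fun d => B t d && B u d) <= Pr mu (B t) * Pr mu (B u)) ->
  (forall t, (#|[set u | ~~ far t u]| <= c)%N) ->
  Pr mu (fun d => ~~ [exists t, B t d]) <= c%:R / (#|T|%:R * p).
Proof.
move=> h h1 p0 T0 hp hfar hc.
set m := \sum_t Pr mu (B t).
have m0 : #|T|%:R * p <= m.
  by rewrite /m mulr_natl -sumr_const; apply: ler_sum => t _.
have Tp : 0 < #|T|%:R * p by rewrite mulr_gt0 ?ltr0n.
have mgt : 0 < m by apply: lt_le_trans m0.
pose X (d : {ffun I -> W}) : R := \sum_t (B t d)%:R.
pose w (d : {ffun I -> W}) := \prod_i mu i (d i).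
have w0 d : 0 <= w d by apply: prodr_ge0 => i _.
have EX : \sum_d X d * w d = m.
  rewrite /m; under [RHS]eq_bigr do rewrite PrE.
  by rewrite exchange_big; apply: eq_bigr => d _; rewrite -mulr_suml.
have E1 : \sum_d w d = 1 by rewrite -(Pr_predT h1).
have EX2 : \sum_d X d ^+ 2 * w d <= m ^+ 2 + c%:R * m.
  have -> : \sum_d X d ^+ 2 * w d = \sum_t \sum_u Pr mu (fun d => B t d && B u d).
    under [RHS]eq_bigr do under eq_bigr do rewrite PrE.
    under [RHS]eq_bigr do rewrite exchange_big.
    rewrite exchange_big; apply: eq_bigr => d _ /=.
    rewrite expr2 {1}/X !mulr_suml; apply: eq_bigr => t _.
    rewrite -mulr_suml; congr (_ * _); rewrite /X mulr_sumr.
    by apply: eq_bigr => u _; rewrite -natrM mulnb.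
  have -> : m ^+ 2 + c%:R * m =
      \sum_t (Pr mu (B t) * m + c%:R * Pr mu (B t)).
    by rewrite big_split /= -mulr_suml -mulr_sumr -/m expr2.
  apply: ler_sum => t _.
  (* Far partners [u] are bounded by the product of the two probabilities, near ones by the
     probability of [B t] alone. *)
  rewrite (bigID (far t)) /=; apply: lerD.
    rewrite /m mulr_sumr [leRHS](bigID (far t)) /=.
    rewrite -[leLHS]addr0; apply: lerD.
      by apply: ler_sum => u; apply: hfar.
    by apply: sumr_ge0 => u _; rewrite mulr_ge0 ?Pr_ge0.
  apply: (@le_trans _ _ (\sum_(u | ~~ far t u) Pr mu (B t))).
    by apply: ler_sum => u _; apply: le_Pr => // d _ /andP[].
  rewrite sumr_const -[leLHS]mulr_natl; apply: ler_wpM2r; first exact: Pr_ge0.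
  by rewrite ler_nat (leq_trans _ (hc t))// cardsE.
(* Where no event occurs, [(X d - m) ^+ 2] equals [m ^+ 2]. *)
have key : Pr mu (fun d => ~~ [exists t, B t d]) * m ^+ 2 <= c%:R * m.
  have : Pr mu (fun d => ~~ [exists t, B t d]) * m ^+ 2
      <= \sum_d (X d - m) ^+ 2 * w d.
    rewrite /Pr mulr_suml [leRHS](bigID (fun d => ~~ [exists t, B t d])) /=.
    rewrite -[leLHS]addr0; apply: lerD; last first.
      by apply: sumr_ge0 => d _; rewrite mulr_ge0 ?sqr_ge0.
    apply: ler_sum => d /existsPn hd.
    suff -> : X d = 0 by rewrite sub0r sqrrN mulrC.
    by rewrite /X big1 // => t _; rewrite (negbTE (hd t)).
  move/le_trans; apply.
  have -> (a : R) : \sum_d (X d - a) ^+ 2 * w d =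
     \sum_d X d ^+ 2 * w d - 2 * a * (\sum_d X d * w d) + a ^+ 2 * \sum_d w d.
    rewrite !mulr_sumr -sumrB -big_split; apply: eq_bigr => d _ /=.
    by move: (X d) (w d) => b e; ring.
  by rewrite EX E1; move: EX2; lra.
have : Pr mu (fun d => ~~ [exists t, B t d]) * m <= c%:R.
  by rewrite -(ler_pM2r mgt) -mulrA -expr2.
rewrite -ler_pdivlMr// => /le_trans; apply.
by apply: ler_wpM2l; rewrite ?ler0n// lef_pV2.
Qed.

End ProductMeasure.

(** * Images of product measures and choices made in two steps *)

Section Pushforward.
Variables (R : realType) (I : finType).

(** Change of variables, one coordinate at a time. It serves twice: to replace sets of edges by sets
    of directions, and to build a random set by adding one element to a smaller one. *)
Lemma Pr_push (W W' : finType) (phi : I -> W -> W') (nu : I -> W -> R)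
    (mu : I -> W' -> R) (A : pred {ffun I -> W'}) :
  (forall i w', mu i w' = \sum_(w | phi i w == w') nu i w) ->
  Pr mu A = Pr nu (fun c => A [ffun i => phi i (c i)]).
Proof.
move=> h; rewrite /Pr.
transitivity (\sum_(c | A c) \sum_(d : {ffun I -> W})
    (if [ffun i => phi i (d i)] == c then \prod_i nu i (d i) else 0)).
  apply: eq_bigr => c _.
  transitivity (\prod_i \sum_w (if phi i w == c i then nu i w else 0)).
    by apply: eq_bigr => i _; rewrite h big_mkcond.
  rewrite bigA_distr_bigA; apply: eq_bigr => d _.
  case: eqP => [/ffunP e|ne].
    by apply: eq_bigr => i _; rewrite -e ffunE eqxx.
  have [/forallP e|/forallPn[i hi]] := boolP [forall i, phi i (d i) == c i].
    by case: ne; apply/ffunP => i; rewrite ffunE; apply/eqP.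
  by rewrite (bigD1 i)//= (negbTE hi) mul0r.
rewrite exchange_big [RHS]big_mkcond; apply: eq_bigr => d _ /=.
rewrite -big_mkcondr /=; case: ifPn => Ad.
  rewrite (big_pred1 [ffun i => phi i (d i)])// => c /=.
  by rewrite [in RHS]eq_sym; case: eqP => [<-|]; rewrite ?Ad ?andbF.
by rewrite big_pred0 // => c; case: eqP => [<-|]; rewrite ?(negbTE Ad) ?andbF.
Qed.

(** Conditioning on the first components: the law [nu2] of the second component at [i] may depend on
    the first one at [i]. *)
Lemma Pr_prod (W1 W2 : finType) (nu1 : I -> W1 -> R) (nu2 : I -> W1 -> W2 -> R)
    (A : pred {ffun I -> W1 * W2}) :
  Pr (fun i w => nu1 i w.1 * nu2 i w.1 w.2) A =
  \sum_(c : {ffun I -> W1}) (\prod_i nu1 i (c i)) *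
     Pr (fun i => nu2 i (c i)) (fun e => A [ffun i => (c i, e i)]).
Proof.
transitivity (\sum_(c : {ffun I -> W1}) \sum_(e : {ffun I -> W2})
   (A [ffun i => (c i, e i)])%:R * \prod_i (nu1 i (c i) * nu2 i (c i) (e i))).
  rewrite PrE pair_big /=.
  rewrite (reindex (fun ce : {ffun I -> W1} * {ffun I -> W2} =>
     [ffun i => (ce.1 i, ce.2 i)])) /=; last first.
    exists (fun d => ([ffun i => (d i).1], [ffun i => (d i).2])) => [[c e] _|d _].
      by congr pair; apply/ffunP => i; rewrite !ffunE.
    by apply/ffunP => i; rewrite !ffunE /=; case: (d i).
  apply: eq_bigr => ce _; congr (_ * _).
  by apply: eq_bigr => i _; rewrite ffunE.
apply: eq_bigr => c _; rewrite PrE mulr_sumr; apply: eq_bigr => e _.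
by rewrite big_split /= mulrCA.
Qed.

End Pushforward.

(** * The cube *)

Section CubeCombinatorics.
Variable n : nat.
Notation V := (cube n).
Implicit Types (v u : V) (i j : 'I_n) (S W X : {set V}).

Definition flip v i : V := [ffun j => v j (+) (j == i)].
(** Neighbours are recorded by direction, so that [#|dirs W v|] is the degree of [v] into [W]. *)
Definition dirs W v : {set 'I_n} := [set i | flip v i \in W].

Lemma flipK i : involutive (flip^~ i).
Proof. by move=> v; apply/ffunP => j; rewrite !ffunE addbK. Qed.

Lemma flip_inj i : injective (flip^~ i).
Proof. exact: inv_inj (flipK i). Qed.

Lemma flip_neq v i : flip v i != v.
Proof. by apply/eqP => /ffunP/(_ i); rewrite ffunE eqxx; case: (v i). Qed.

Lemma flip_injr v : injective (flip v).
Proof.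
by move=> i j /ffunP/(_ i); rewrite !ffunE eqxx => /addbI/esym/eqP.
Qed.

Lemma flip2_neq v i j k : flip (flip v i) j != flip v k.
Proof.
apply/eqP; have [->|ij] := eqVneq i j.
  by rewrite flipK => /esym/eqP; rewrite (negbTE (flip_neq _ _)).
move=> /ffunP e; move: (e i) (e j).
rewrite !ffunE !eqxx (negbTE ij) [j == i]eq_sym (negbTE ij) !addbF.
by move=> /addbI/esym/eqP ik /addbI/esym/eqP jk; rewrite ik jk eqxx in ij.
Qed.

Lemma card_cube : #|V| = (2 ^ n)%N.
Proof. by rewrite card_ffun card_bool card_ord. Qed.

Lemma card_dirs_le W v : (#|dirs W v| <= n)%N.
Proof. by rewrite -[leqRHS]card_ord max_card. Qed.

Lemma dirsU W W' v : dirs (W :|: W') v = dirs W v :|: dirs W' v.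
Proof. by apply/setP => i; rewrite !inE. Qed.

Lemma card_dirs_le_card W v : (#|dirs W v| <= #|W|)%N.
Proof.
rewrite -(card_imset _ (@flip_injr v)); apply: subset_leq_card.
by apply/subsetP => _ /imsetP[i ii ->]; rewrite inE in ii.
Qed.

(* Adjacent vertices of the cube have no common neighbour. *)
Lemma card_dirs_adjacent X v i :
  (#|dirs X v| + #|dirs X (flip v i)| <= #|X|)%N.
Proof.
rewrite -(card_imset _ (@flip_injr v)) -(card_imset _ (@flip_injr (flip v i))).
rewrite -cardsUI.
have -> : (flip v @: dirs X v) :&: (flip (flip v i) @: dirs X (flip v i)) = set0.
  apply/setP => x; rewrite !inE; apply/negP => /andP[/imsetP[a _ ->]].
  by case/imsetP=> b _ /esym/eqP; rewrite (negbTE (flip2_neq _ _ _ _)).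
rewrite cards0 addn0; apply: subset_leq_card; apply/subsetP => x.
by rewrite inE => /orP[]/imsetP[a + ->]; rewrite inE.
Qed.

(** As [X] has fewer than [k] vertices, [v] has a neighbour inside [S]. Each of these two adjacent
    vertices has at most [#|S| - 1] neighbours in [S], and together they have at most [#|X|] in [X];
    adding their degrees gives the bound. *)
Lemma card_separated (k : nat) S X v :
  v \in S -> (#|X| < k)%N -> (forall u, u \in S -> (k <= #|dirs (S :|: X) u|)%N) ->
  (k <= 2 * #|S|)%N.
Proof.
move=> vS Xk h.
have d1 u : u \in S -> (#|dirs S u| <= #|S|.-1)%N.
  move=> uS; rewrite -ltnS prednK; last by rewrite card_gt0; apply/set0Pn; exists v.
  rewrite -(card_imset _ (@flip_injr u)); apply: proper_card.
  apply/properP; split.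
    by apply/subsetP => _ /imsetP[a + ->]; rewrite inE.
  exists u => //; apply/negP => /imsetP[a _ e].
  by move: (flip_neq u a); rewrite -e eqxx.
have h' u : u \in S -> (k <= #|S|.-1 + #|dirs X u|)%N.
  move=> uS; apply: leq_trans (h u uS) _; rewrite dirsU.
  by apply: leq_trans (leq_card_setU _ _) _; rewrite leq_add2r d1.
have S0 : (0 < #|S|)%N by rewrite card_gt0; apply/set0Pn; exists v.
have [i ii] : exists i, flip v i \in S.
  have : (0 < #|dirs S v|)%N.
    rewrite lt0n; apply/negP => /eqP e0.
    have := h v vS; rewrite dirsU.
    move/leq_trans/(_ (leq_card_setU _ _)); rewrite e0 add0n.
    move/leq_trans/(_ (card_dirs_le_card _ _)).
    by rewrite leqNgt Xk.
  by rewrite card_gt0 => /set0Pn[i]; rewrite inE; exists i.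
have := card_dirs_adjacent X v i.
have := h' _ vS; have := h' _ ii; move: Xk S0.
set a := #|dirs X v|; set b := #|dirs X _|; set s := #|S|; set x := #|X|.
by lia.
Qed.

End CubeCombinatorics.

(** * The edge-isoperimetric inequality of the cube *)

Section EdgeIsoperimetry.
Variables (R : realType) (n : nat).
Notation V := (cube n).
Implicit Types (v u : V) (i j : 'I_n) (S W X : {set V}).

Lemma ln2_gt0 : 0 < ln 2 :> R.
Proof. by rewrite ln_gt0 // ltr1n. Qed.

(** By concavity the logarithm lies above its chord between 1 and 2. *)
Lemma ln1D_ge (t : R) : 0 <= t <= 1 -> t * ln 2 <= ln (1 + t).
Proof.
move=> /andP[t0 t1].
have := @concave_ln R (Itv01 t0 t1) 2 1 (ltr0n _ 2) ltr01.
rewrite !convRE /= ln1 mulr0 addr0 mulr1 => h; apply: le_trans h _.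
by rewrite (_ : _ + _ = 1 + t) // /unstable.onem; ring.
Qed.

(** The induction step of the isoperimetric inequality: [a] and [b] are the sizes of two opposite
    parts, and [2 * a] bounds the crossing edges counted from both ends. One gain of [a * ln 2]
    comes from [2 * a <= a + b], the other from [ln1D_ge] at [a / b]. *)
Lemma xlnx_superadditive (a b : R) : 0 <= a -> a <= b ->
  a * ln a + b * ln b + 2 * a * ln 2 <= (a + b) * ln (a + b).
Proof.
rewrite le_eqVlt => /predU1P[<- _|a0 ab].
  by rewrite !mul0r mulr0 mul0r addr0 !add0r.
have b0 : 0 < b by apply: lt_le_trans ab.
have h1 : ln a + ln 2 <= ln (a + b).
  rewrite -lnM ?posrE// ler_ln ?posrE ?mulr_gt0 ?addr_gt0//; lra.
have h2 : b * ln b + a * ln 2 <= b * ln (a + b).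
  have -> : a + b = b * (1 + a / b) by field; rewrite gt_eqF.
  have ab0 : 0 < a / b by rewrite divr_gt0.
  rewrite lnM ?posrE//; last by rewrite addr_gt0.
  have : a / b * ln 2 <= ln (1 + a / b).
    by apply: ln1D_ge; rewrite (ltW ab0) ler_pdivrMr// mul1r.
  rewrite -(ler_pM2l b0) mulrA [b * (a / b)]mulrC divfK ?gt_eqF// mulrDr; lra.
have h3 : a * ln a + a * ln 2 <= a * ln (a + b).
  by rewrite -mulrDr ler_pM2l.
by rewrite mulrDl; lra.
Qed.

(** Induction on [#|S|]. The left side counts every inner edge twice. A coordinate on which two
    points of [S] differ cuts [S] into nonempty parts, and the crossing edges form a matching
    between them. *)
Lemma edge_isoperimetry S :
  (\sum_(v in S) #|dirs S v|)%:R * ln 2 <= #|S|%:R * ln #|S|%:R :> R.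
Proof.
have [m] := ubnP #|S|; elim: m S => // m IH S; rewrite ltnS => Sm.
have [S1|S1] := leqP #|S| 1.
  rewrite big1 ?mul0r; last first.
    move=> v vS; apply/eqP; rewrite cards_eq0; apply/eqP/setP => i; rewrite !inE.
    apply/negP => fS; have /cards1P[x Sx] : #|S| == 1%N.
    by rewrite eqn_leq S1 card_gt0; apply/set0Pn; exists v.
  move: fS vS; rewrite Sx !inE => /eqP <-.
  by rewrite eq_sym (negbTE (flip_neq _ _)).
  have [->|c0] := posnP #|S|; first by rewrite mul0r.
  by rewrite mulr_ge0 // ln_ge0 // ler1n.
have [u [v [uS vS uv]]] : exists u v, [/\ u \in S, v \in S & u != v].
  by move/card_gt1P: S1 => [u [v [? ? ?]]]; exists u, v.
have [i uvi] : exists i, u i != v i.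
  apply/existsP; apply: contraNT uv => /existsPn h.
  by apply/eqP/ffunP => i; apply/eqP; have := h i; rewrite negbK.
pose P b := [set x in S | x i == b].
have PS b : P b \subset S by apply/subsetP => x; rewrite inE => /andP[].
have SU : #|S| = (#|P false| + #|P true|)%N.
  rewrite -cardsUI [_ :&: _](_ : _ = set0) ?cards0 ?addn0; last first.
    by apply/setP => x; rewrite !inE; case: (x i); rewrite ?andbF.
  by congr #|pred_of_set _|; apply/setP => x; rewrite !inE;
    case: (x i); rewrite ?andbT ?andbF ?orbF.
have Pn b : (0 < #|P b|)%N.
  rewrite card_gt0; apply/set0Pn.
  have [e|e] := eqVneq (u i) b; first by exists u; rewrite inE uS e eqxx.
  by exists v; rewrite inE vS; move: uvi e; case: (u i); case: (v i); case: b.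
have Pm b : (#|P b| < m)%N.
  by apply: leq_trans Sm; move: SU (Pn b) (Pn (~~ b)); case: b => /=; lia.
(* Flipping [i] injects the vertices of one part that have a crossing edge into the other part. *)
have cross b : (\sum_(x in P b) (flip x i \in S) <= #|P (~~ b)|)%N.
  rewrite -big_mkcondr /= sum1_card.
  rewrite -(card_imset _ (@flip_inj n i)); apply: subset_leq_card.
  apply/subsetP => _ /imsetP[x + ->].
  move=> /andP[]; rewrite !inE => /andP[xS /eqP xb] ->.
  by rewrite ffunE eqxx xb; case: (b).
have deg b x : x \in P b -> (#|dirs S x| <= #|dirs (P b) x| + (flip x i \in S))%N.
  rewrite inE => /andP[xS /eqP xb].
  rewrite (cardsD1 i (dirs S x)) addnC inE leq_add2r.
  apply: subset_leq_card; apply/subsetP => j; rewrite !inE => /andP[ji ->].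
  by rewrite ffunE [i == j]eq_sym (negbTE ji) addbF xb eqxx.
have sumP b : (\sum_(x in P b) #|dirs S x| <=
    \sum_(x in P b) #|dirs (P b) x| + minn #|P b| #|P (~~ b)|)%N.
  apply: (@leq_trans (\sum_(x in P b) (#|dirs (P b) x| + (flip x i \in S)))%N).
    by apply: leq_sum => x; apply: deg.
  rewrite big_split leq_add2l leq_min cross andbT -sum1_card.
  by apply: leq_sum => x _; case: (_ \in _).
have tot : (\sum_(x in S) #|dirs S x| = \sum_(x in P false) #|dirs S x| +
     \sum_(x in P true) #|dirs S x|)%N.
  rewrite (bigID (fun x : V => x i)) /= addnC; congr addn.
    by apply: eq_bigl => x; rewrite !inE; case: (x i).
  by apply: eq_bigl => x; rewrite !inE; case: (x i).
have I0 := IH _ (Pm false); have I1 := IH _ (Pm true).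
have tot' : (\sum_(x in S) #|dirs S x| <= \sum_(x in P false) #|dirs (P false) x| +
   \sum_(x in P true) #|dirs (P true) x| +
    (minn #|P false| #|P true| + minn #|P false| #|P true|))%N.
  rewrite tot; apply: leq_trans (leq_add (sumP false) (sumP true)) _.
  by rewrite [minn #|P true| _]minnC addnACA.
move: tot'; rewrite -(ler_nat R) -(ler_pM2r ln2_gt0) => /le_trans; apply.
rewrite !natrD !mulrDl SU natrD.
move: I0 I1; have [c|c] := leqP #|P false| #|P true| => I0 I1.
  have := @xlnx_superadditive #|P false|%:R #|P true|%:R (ler0n _ _).
  by rewrite ler_nat => /(_ c); rewrite -/(2%:R); lra.
have := @xlnx_superadditive #|P true|%:R #|P false|%:R (ler0n _ _).
rewrite ler_nat => /(_ (ltnW c)).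
by rewrite [#|P true|%:R + #|P false|%:R]addrC; lra.
Qed.

End EdgeIsoperimetry.

(** * The k-out graph *)

Section ChoiceModel.
Variables (R : realType) (n : nat).
Notation V := (cube n).
Notation config := {ffun V -> {set 'I_n}}.
Implicit Types (v u : V) (i j : 'I_n) (S W X : {set V}) (D : config).

Lemma cube_adjP u v : reflect (exists i, v = flip u i) (cube_adj u v).
Proof.
apply: (iffP idP) => [/cards1P[i e]|[i ->]].
  exists i; apply/ffunP => j; rewrite ffunE.
  move/setP/(_ j): e; rewrite !inE => <-; by case: (u j); case: (v j).
apply/cards1P; exists i; apply/setP => j; rewrite !inE ffunE.
by case: (u j); case: (j == i).
Qed.

Lemma set2_eqP (T : finType) (a b c d : T) : a != b ->
  [set a; b] = [set c; d] -> (a = c /\ b = d) \/ (a = d /\ b = c).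
Proof.
move=> ab /setP e; move: (e a) (e b); rewrite !inE !eqxx orbT /= => /esym/orP h1 /esym/orP h2.
case: h1 h2 ab => /eqP -> [] /eqP ->; rewrite ?eqxx // => _; by [left|right].
Qed.

Definition star v (A : {set 'I_n}) : {set {set V}} :=
  [set [set v; flip v i] | i in A].

Lemma edge_inj v : injective (fun i => [set v; flip v i]).
Proof.
move=> i j /set2_eqP -/(_ _)[|[_ /flip_injr]//|[e _]].
  by rewrite eq_sym flip_neq.
by have := flip_neq v j; rewrite -e eqxx.
Qed.

Lemma mem_star v A i : ([set v; flip v i] \in star v A) = (i \in A).
Proof. exact: mem_imset (@edge_inj v). Qed.

Lemma incident_edgesE v : incident_edges v = star v setT.
Proof.
apply/setP => e; rewrite inE; apply/andP/imsetP => [[/imsetP[[a b] /= +]]|[i _ ->]].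
  rewrite inE => /cube_adjP[i /= ->] ->; rewrite !inE => /orP[]/eqP->; exists i; rewrite ?inE //.
  by rewrite /= flipK setUC.
split; last by rewrite !inE eqxx.
apply/imsetP; exists (v, flip v i) => //; rewrite inE; apply/cube_adjP; by exists i.
Qed.

Lemma star_inj v : injective (star v).
Proof. exact: imset_inj (@edge_inj v). Qed.

Lemma card_star v A : #|star v A| = #|A|.
Proof. exact: card_imset (@edge_inj v). Qed.

Definition unif (k : nat) (A : {set 'I_n}) : R :=
  if #|A| == k then ('C(n, k)%:R)^-1 else 0.

Lemma unif_ge0 k A : 0 <= unif k A.
Proof. by rewrite /unif; case: ifP => // _; rewrite invr_ge0 ler0n. Qed.

Lemma sum_unif k (P : {set 'I_n}) : \sum_(A : {set 'I_n} | A \subset P) unif k A =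
  'C(#|P|, k)%:R / 'C(n, k)%:R.
Proof.
rewrite /unif -big_mkcondr /= sumr_const -[LHS]mulr_natl.
by rewrite -cards_draws cardsE.
Qed.

Lemma sum_unifT k : (k <= n)%N -> \sum_A unif k A = 1.
Proof.
move=> kn; rewrite (eq_bigl (fun A : {set 'I_n} => A \subset setT)); last first.
  by move=> A; rewrite subsetT.
by rewrite sum_unif cardsT card_ord divff // pnatr_eq0 -lt0n bin_gt0.
Qed.

Definition kgraph D : {set {set V}} := kout_edges [ffun v => star v (D v)].

(** The map [star v] is injective and carries the [k]-sets of directions onto the [k]-sets of edges
    at [v], so it transports [unif k] to the mass in the definition of the model. *)
Lemma kout_probE k (A : pred {set {set V}}) :
  kout_prob R n k A = Pr (fun=> unif k) (fun D => A (kgraph D)).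
Proof.
rewrite /kout_prob /kout_mass.
rewrite -[LHS]/(Pr (fun v (E : {set {set V}}) =>
   if (E \subset incident_edges v) && (#|E| == k) then ('C(n, k)%:R)^-1 else 0)
   (fun c => A (kout_edges c))).
rewrite (Pr_push (phi := star) (nu := fun=> unif k)) // => v E.
case: ifPn => [/andP[Ev Ek]|].
  have [B EB] : exists B, E = star v B.
    exists [set i | [set v; flip v i] \in E]; apply/setP => e; apply/idP/imsetP.
      move=> eE; move/subsetP/(_ _ eE): Ev; rewrite incident_edgesE => /imsetP[i _ ee].
      by exists i => //; rewrite inE -ee.
    by case=> i; rewrite inE => ? ->.
  have e C : (star v C == star v B) = (C == B) by rewrite (inj_eq (@star_inj v)).
  rewrite EB (eq_bigl _ _ e) big_pred1_eq.
  by rewrite /unif -(card_star v) -EB Ek.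
move=> h; rewrite big1 // => B /eqP e; rewrite /unif; case: ifP => // /eqP k'.
by move: h; rewrite -e card_star k' eqxx andbT incident_edgesE imsetS ?subsetT.
Qed.

Definition adjD D : rel V :=
  fun u v => [exists i, (v == flip u i) && ((i \in D u) || (i \in D v))].

Lemma adjDP D u v :
  reflect (exists2 i, v = flip u i & (i \in D u) || (i \in D v)) (adjD D u v).
Proof.
by apply: (iffP existsP) => [[i /andP[/eqP ? ?]]|[i ? ?]]; exists i => //;
  apply/andP; split => //; apply/eqP.
Qed.

Lemma adjD_sym D : symmetric (adjD D).
Proof.
suff h u v : adjD D u v -> adjD D v u by move=> u v; apply/idP/idP; apply: h.
by case/adjDP => i -> h; apply/adjDP; exists i; rewrite ?flipK // orbC.
Qed.

Lemma gadj_kgraph D : gadj (kgraph D) =2 adjD D.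
Proof.
move=> u v; rewrite /gadj /=; apply/andP/adjDP => [[uv /bigcupP[w _]]|[i ->]].
  rewrite ffunE => /imsetP[i iD /(set2_eqP uv)[[-> ->]|[-> ->]]]; exists i => //.
  - by rewrite iD.
  - by rewrite flipK.
  - by rewrite iD orbT.
rewrite eq_sym flip_neq => /orP h; split => //; apply/bigcupP; case: h => h.
  by exists u => //; rewrite ffunE mem_star.
exists (flip u i) => //; rewrite ffunE setUC -{2}[u](flipK i); first by rewrite mem_star.
Qed.

Definition adjIn D S : rel V := [rel u v | [&& u \in S, v \in S & adjD D u v]].

Lemma adjIn_sym D S : symmetric (adjIn D S).
Proof. by move=> u v; rewrite /adjIn /= adjD_sym andbCA. Qed.

Lemma connected_on_kgraph D S : connected_on (kgraph D) S =
  [forall x in S, forall y in S, connect (adjIn D S) x y].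
Proof.
rewrite /connected_on; apply: eq_forallb => x; congr (_ ==> _).
apply: eq_forallb => y; congr (_ ==> _); apply: eq_connect => u v /=.
by rewrite gadj_kgraph.
Qed.

Lemma connect_closed (T : finType) (r : rel T) (C : {set T}) (x y : T) :
  (forall u v : T, u \in C -> r u v -> v \in C) -> connect r x y -> x \in C -> y \in C.
Proof.
move=> h /connectP[p + ->]; elim: p x => //= z p IH x /andP[rxz pz] xC.
exact: IH pz (h _ _ xC rxz).
Qed.

Definition comp D S x : {set V} := [set y | connect (adjIn D S) x y].

Lemma comp_refl D S x : x \in comp D S x.
Proof. by rewrite inE connect0. Qed.

Lemma comp_sub D S x : x \in S -> comp D S x \subset S.
Proof.
move=> xS; apply/subsetP => y; rewrite inE => /connect_closed; apply => //.
by move=> u v _ /and3P[].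
Qed.

Lemma comp_closed D S x u v : u \in comp D S x -> adjIn D S u v -> v \in comp D S x.
Proof. by rewrite !inE => h /connect1/(connect_trans h). Qed.

Lemma comp_eq D S x y : y \in comp D S x -> comp D S y = comp D S x.
Proof.
rewrite inE => xy; apply/setP => z; rewrite !inE.
by rewrite (same_connect (sym_connect_sym (@adjIn_sym D S)) xy).
Qed.

(** Two vertices not joined outside [X] have disjoint components, and the smaller one fills at most
    half of the cube. *)
Lemma not_kconnected D (l : nat) : (l < 2 ^ n)%N -> ~~ kconnected (kgraph D) l ->
  exists X x, [/\ (#|X| < l)%N, x \notin X & (2 * #|comp D (~: X) x| <= 2 ^ n)%N].
Proof.
rewrite /kconnected card_cube => -> /= /forallPn[X]; rewrite negb_imply connected_on_kgraph.
case/andP=> Xl /forall_inPn[x xX /forall_inPn[y yX nxy]].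
have dis : comp D (~: X) x :&: comp D (~: X) y = set0.
  apply/setP => z; rewrite !inE; apply/negP => /andP[xz yz].
  move/negP: nxy; apply; apply: connect_trans xz _.
  by rewrite (sym_connect_sym (@adjIn_sym D _)).
have : (#|comp D (~: X) x :|: comp D (~: X) y| <= 2 ^ n)%N.
  by rewrite -card_cube max_card.
have := cardsUI (comp D (~: X) x) (comp D (~: X) y); rewrite dis cards0 addn0 => -> h.
case: (leqP #|comp D (~: X) x| #|comp D (~: X) y|) => c.
  exists X, x; split => //; first by rewrite inE in xX.
  by rewrite mul2n -addnn (leq_trans _ h) // leq_add2l.
exists X, y; split => //; first by rewrite inE in yX.
by rewrite mul2n -addnn (leq_trans _ h) // leq_add2r ltnW.
Qed.

(** Connectedness in the cube itself, whatever the choices, so that candidate components can be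
    counted once and for all. It is stated as the possibility to grow from a root, which is what the
    construction of a walk uses. *)
Definition conn S : bool := [exists x in S, [forall A : {set V},
  (x \in A) && (A \proper S) ==> [exists u in A, exists i, flip u i \in S :\: A]]].

Lemma conn_comp D S x : conn (comp D S x).
Proof.
apply/exists_inP; exists x; first exact: comp_refl.
apply/forallP => A; apply/implyP => /andP[xA /properP[AS [y yC yA]]].
apply: contraNT yA => /exists_inPn h.
move: (yC); rewrite inE => /connect_closed; apply => // u v uA uv.
have := comp_closed (subsetP AS _ uA) uv.
case/and3P: uv => _ _ /adjDP[i -> _] fC.
have /existsPn/(_ i) := h u uA.
by rewrite inE fC andbT negbK.
Qed.

(** The vertices visited by the walk that starts at [x] and follows the directions [ds]. *)
Definition wset (x : V) (ds : seq 'I_n) : {set V} :=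
  [set y in x :: scanl (@flip n) x ds].

Lemma wset_cons x i ds : wset x (i :: ds) = x |: wset (flip x i) ds.
Proof. by apply/setP => y; rewrite !inE. Qed.

(** At a visit to [u] the walk makes a detour to [flip u i] and back, which costs two steps. *)
Lemma wset_ins x ds u i : u \in wset x ds -> exists2 ds',
  size ds' = (size ds).+2 & wset x ds' = flip u i |: wset x ds.
Proof.
elim: ds x => [|j ds IH] x.
  rewrite !inE ?orbF => /eqP ->; exists [:: i; i] => //.
  by apply/setP => y; rewrite !inE /= flipK; do 2 case: (y == _).
rewrite wset_cons in_setU1 => /orP[/eqP ->|h].
  exists [:: i, i, j & ds] => //.
  rewrite !wset_cons flipK; apply/setP => y; rewrite !inE.
  by do 2 case: (y == _).
have [ds' s e] := IH _ h; exists (j :: ds'); first by rewrite /= s.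
by rewrite wset_cons e setUCA.
Qed.

(* The walk goes around a spanning tree. *)
Lemma conn_wset S : conn S ->
  exists x (t : (2 * #|S|.-1).-tuple 'I_n), S = wset x t.
Proof.
case/exists_inP => x xS /forallP h; exists x.
suff H m : (m < #|S|)%N -> exists ds, [/\ size ds = (2 * m)%N, wset x ds \subset S,
    #|wset x ds| = m.+1 & x \in wset x ds].
  have S0 : (0 < #|S|)%N by rewrite card_gt0; apply/set0Pn; exists x.
  have [|ds [s ds1 c _]] := H #|S|.-1; first by rewrite prednK.
  exists (tcast s (in_tuple ds)); rewrite val_tcast /=.
  by symmetry; apply/eqP; rewrite eqEcard ds1 c prednK // leqnn.
elim: m => [_|m IH mS].
  exists [::]; split => //; last by rewrite !inE eqxx.
    by apply/subsetP => y; rewrite !inE ?orbF => /eqP ->.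
  by apply/eqP/cards1P; exists x; apply/setP => y; rewrite !inE ?orbF.
have [ds [s dS c xd]] := IH (ltnW mS).
have := h (wset x ds); rewrite xd properEcard dS c mS /=.
case/exists_inP => u ud /existsP[i]; rewrite inE => /andP[fd fS].
have [ds' s' e] := wset_ins i ud; exists ds'; split.
- by rewrite s' s; lia.
- by rewrite e subUset sub1set fS.
- by rewrite e cardsU1 fd c.
- by rewrite e inE xd orbT.
Qed.

(** A connected set is determined by the starting vertex and the directions of a walk of [2 * s.-1]
    steps that covers it. *)
Lemma card_conn (s : nat) : (0 < n)%N ->
  (#|[set S : {set V} | conn S & #|S| == s]| <= 2 ^ n * n ^ (2 * s))%N.
Proof.
move=> n0; apply: (@leq_trans (2 ^ n * n ^ (2 * s.-1))%N); last first.
  by rewrite leq_mul2l leq_pexp2l ?orbT // leq_mul2l leq_pred.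
have -> : (2 ^ n * n ^ (2 * s.-1))%N = #|{: V * (2 * s.-1).-tuple 'I_n}|.
  by rewrite card_prod card_cube card_tuple card_ord.
rewrite -cardsT.
apply: leq_trans (leq_imset_card (fun p : V * (2 * s.-1).-tuple 'I_n => wset p.1 p.2) setT).
apply: subset_leq_card; apply/subsetP => S; rewrite inE => /andP[/conn_wset[x [t e]] /eqP c].
by subst s; apply/imsetP; exists (x, t).
Qed.

End ChoiceModel.

(** * Isolated subcubes *)

Section IsolatedSubcubes.
Variables (R : realType) (n k : nat).
Hypothesis kn : (k < n)%N.
Notation V := (cube n).
Implicit Types (x y u v : V) (i j : 'I_n) (A : {set 'I_n}).

Definition low : {set 'I_n} := [set i : 'I_n | (i < k)%N].

Definition subcube x : {set V} :=
  [set v : V | [forall i, (i \notin low) ==> (v i == x i)]].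

(** The part of the isolation of [subcube x] that concerns the choice at [v] alone; isolation thus
    becomes a conjunction over the vertices, to which [Pr_forall] applies. *)
Definition isolating x v : pred {set 'I_n} := fun A =>
  ((v \in subcube x) ==> (A == low)) &&
  [forall i, (i \notin low) && (flip v i \in subcube x) ==> (i \notin A)].

Definition isolated x (D : {ffun V -> {set 'I_n}}) : bool :=
  [forall v, isolating x v (D v)].

Lemma subcubeP x v :
  reflect (forall i, i \notin low -> v i = x i) (v \in subcube x).
Proof.
rewrite inE; apply: (iffP forallP) => h i.
  by move=> il; have /implyP/(_ il)/eqP := h i.
by apply/implyP => il; rewrite h.
Qed.

Lemma subcube_refl x : x \in subcube x.
Proof. exact/subcubeP. Qed.

Lemma subcube_sym x y : (x \in subcube y) = (y \in subcube x).
Proof. by apply/subcubeP/subcubeP => h i il; rewrite h. Qed.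

Lemma card_low : #|low| = k.
Proof.
rewrite -sum1_card (eq_bigl (fun i : 'I_n => (i < k)%N)); last by move=> i; rewrite inE.
by rewrite (big_ord_narrow (ltnW kn)) sum1_card card_ord.
Qed.

Lemma card_subcube x : (#|subcube x| <= 2 ^ k)%N.
Proof.
pose f v := [ffun j : 'I_k => v (widen_ord (ltnW kn) j)].
have fi : {in subcube x &, injective f}.
  move=> u v /subcubeP hu /subcubeP hv /ffunP e; apply/ffunP => i.
  have [il|il] := boolP (i \in low); last by rewrite hu // hv.
  rewrite inE in il; have := e (Ordinal il); rewrite !ffunE.
  by rewrite (_ : widen_ord _ _ = i) //; apply: val_inj.
rewrite -(card_in_imset fi); apply: leq_trans (max_card _) _.
by rewrite card_ffun card_bool card_ord.
Qed.

Lemma isolated_disconnected x D : isolated x D -> ~~ gconnected (kgraph D).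
Proof.
move/forallP => h; rewrite /gconnected connected_on_kgraph.
(* As [k < n], the last direction is not in [low], and flipping it leads out of the subcube. *)
have lown : (n.-1 < n)%N by case: (n) kn.
have nl : Ordinal lown \notin low by rewrite inE -leqNgt /=; case: (n) kn.
apply/forall_inPn; exists x; rewrite ?inE //; apply/forall_inPn.
exists (flip x (Ordinal lown)); rewrite ?inE //; apply/negP => c.
suff cl u v : u \in subcube x -> adjIn D setT u v -> v \in subcube x.
  have /subcubeP/(_ _ nl) := connect_closed cl c (subcube_refl x).
  by rewrite ffunE eqxx; case: (x _).
move=> us /and3P[_ _ /adjDP[i -> hi]].
have [il|il] := boolP (i \in low).
  apply/subcubeP => j jl; rewrite ffunE (subcubeP _ _ us) //.
  by case: eqP => [e|]; rewrite ?addbF //; rewrite e il in jl.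
case/orP: hi => hi.
  have /andP[/implyP/(_ us)/eqP e _] := h u.
  by rewrite e (negbTE il) in hi.
have /andP[_ /forallP/(_ i)] := h (flip u i).
by rewrite il flipK us hi.
Qed.

(** The subcube with its neighbours: the vertices whose choices can matter for its isolation. *)
Definition block x : {set V} :=
  subcube x :|: \bigcup_i [set v | flip v i \in subcube x].

Lemma isolatingT x v A : v \notin block x -> isolating x v A.
Proof.
rewrite in_setU negb_or => /andP[vC vB]; rewrite /isolating (negbTE vC) /=.
apply/forallP => i; apply/implyP => /andP[_ fC].
by case/negP: vB; apply/bigcupP; exists i => //; rewrite inE.
Qed.

Lemma card_block x : (#|block x| <= n.+1 * 2 ^ k)%N.
Proof.
apply: leq_trans (leq_card_setU _ _) _; rewrite mulSn leq_add ?card_subcube //.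
apply: (@leq_trans (\sum_(i : 'I_n) #|[set v | flip v i \in subcube x]|)%N).
  elim/big_ind2: _ => [|a A b B ha hb|//]; first by rewrite cards0.
  by apply: leq_trans (leq_card_setU _ _) (leq_add ha hb).
rewrite -[X in (_ <= X * _)%N](card_ord n) -sum_nat_const.
apply: leq_sum => i _; rewrite -(card_imset _ (@flip_inj n i)).
apply: leq_trans (card_subcube x); apply: subset_leq_card.
by apply/subsetP => _ /imsetP[v + ->]; rewrite inE.
Qed.

Lemma block_sym x v : (v \in block x) = (x \in block v).
Proof.
suff h a b : a \in block b -> b \in block a by apply/idP/idP; apply: h.
rewrite !in_setU subcube_sym => /orP[->//|/bigcupP[i _]].
rewrite inE => /subcubeP e; apply/orP; right; apply/bigcupP; exists i => //.
rewrite inE; apply/subcubeP => j jl; have := e j jl; rewrite !ffunE => <-.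
by rewrite addbK.
Qed.

(** By [block_sym], a [y] whose block meets [block x] in [v] lies in [block v]; hence the square of
    the size of a block. *)
Lemma card_meeting x :
  (#|[set y | ~~ [disjoint block x & block y]]| <= (n.+1 * 2 ^ k) ^ 2)%N.
Proof.
apply: (@leq_trans #|\bigcup_(v in block x) block v|).
  apply: subset_leq_card; apply/subsetP => y; rewrite inE => /pred0Pn[v /= /andP[vx vy]].
  by apply/bigcupP; exists v; rewrite // block_sym.
apply: (@leq_trans (\sum_(v in block x) #|block v|)%N).
  elim/big_ind2: _ => [|a A b B ha hb|//]; first by rewrite cards0.
  by apply: leq_trans (leq_card_setU _ _) (leq_add ha hb).
apply: (@leq_trans (\sum_(v in block x) n.+1 * 2 ^ k)%N).
  by apply: leq_sum => v _; apply: card_block.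
by rewrite sum_nat_const expnS expn1 leq_mul2r card_block orbT.
Qed.

(** A lower bound for the probability of isolation: one factor for each vertex inside and one for
    each outer neighbour. The second exponent counts the whole block, which only decreases the
    value, as the base is at most 1. *)
Definition isolation_prob : R :=
  ('C(n, k)%:R^-1) ^+ (2 ^ k) * (1 - k%:R / n%:R) ^+ (n.+1 * 2 ^ k).

Lemma n_gt0 : (0 < n)%N. Proof. by case: (n) kn. Qed.

Lemma density_complement_bounds : 0 <= (1 : R) - k%:R / n%:R <= 1.
Proof.
have n0 := n_gt0.
rewrite subr_ge0 ler_pdivrMr ?ltr0n // mul1r ler_nat ltnW //.
by rewrite /= gerBl divr_ge0.
Qed.

Lemma Pr_isolated_ge x : isolation_prob <= Pr (fun=> unif R k) (isolated x).
Proof.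
have n0 := n_gt0; have /andP[b0 b1] := density_complement_bounds.
rewrite Pr_forall.
pose a : R := 'C(n, k)%:R^-1; pose b : R := 1 - k%:R / n%:R.
have a0 : 0 <= a by rewrite invr_ge0.
have a1 : a <= 1 by rewrite invf_le1 ?ltr0n ?bin_gt0 ?(ltnW kn) // ler1n bin_gt0 ltnW.
apply: (@le_trans _ _ (\prod_v (if v \in subcube x then a else
    if v \in block x then b else 1))).
  apply: (@le_trans _ _ (a ^+ #|subcube x| * b ^+ #|block x|)).
    apply: ler_pM; rewrite ?exprn_ge0 //.
      by apply: ler_wiXn2l => //; apply: card_subcube.
    by apply: ler_wiXn2l => //; apply: card_block.
  rewrite (bigID (mem (subcube x))) /=; apply: ler_pM; rewrite ?exprn_ge0 //.
    by rewrite -prodr_const le_eqVlt; apply/orP; left; apply/eqP/eq_bigr => v ->.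
  rewrite [leRHS](eq_bigr (fun v => if v \in block x then b else 1)); last first.
    by move=> v /negbTE ->.
  rewrite -big_mkcondr /= prodr_const; apply: ler_wiXn2l => //.
  apply: subset_leq_card; apply/subsetP => v; by case/andP.
apply: ler_prod => v _; case: ifPn => [vC|vC].
  rewrite a0 /= (bigD1 low) /=; last first.
    rewrite /isolating vC eqxx; apply/forallP => i; apply/implyP => /andP[//].
  rewrite /unif card_low eqxx lerDl; apply: sumr_ge0 => A _.
  by rewrite unif_ge0.
case: ifPn => [vB|vB]; last first.
  rewrite ler01 /= (eq_bigl predT); first by rewrite sum_unifT // ltnW.
  by move=> A; apply: isolatingT.
rewrite b0 /=; move: vB; rewrite in_setU (negbTE vC) => /bigcupP[i _]; rewrite inE => iC.
have il : i \notin low.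
  apply: contra vC => il; apply/subcubeP => j jl; have /subcubeP/(_ j jl) := iC.
  by rewrite ffunE; case: eqP => [e|_]; rewrite ?addbF //; rewrite e il in jl.
(* From an outer neighbour only the direction [i] leads into the subcube, so it is enough that the
   choice avoids [i]. *)
apply: (@le_trans _ _ (\sum_(A : {set 'I_n} | A \subset ~: [set i]) unif R k A)).
  rewrite sum_unif cardsC1 card_ord /b.
  (* The multiplicity [(0 < k)] covers [k = 0], where [k.-1] is 0 and the binomial quotient would
     not vanish. *)
  have -> : k%:R / n%:R = 'C(n.-1, k.-1)%:R / 'C(n, k)%:R *+ (0 < k)%N :> R.
    case: (k) kn => [|k' k'n]; first by rewrite mul0r.
    rewrite mulr1n; have c0 : 'C(n, k'.+1)%:R != 0 :> R by rewrite pnatr_eq0 -lt0n bin_gt0 ltnW.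
    have n0' : n%:R != 0 :> R by rewrite pnatr_eq0 -lt0n.
    apply/eqP; rewrite eqr_div //; apply/eqP; rewrite -!natrM.
    by case: (n) n0 k'n => // n' _ _; rewrite [in RHS]mulnC -mul_bin_diag.
  have c0 : 'C(n, k)%:R != 0 :> R by rewrite pnatr_eq0 -lt0n bin_gt0 ltnW.
  rewrite lerBlDr; case: (k) kn c0 => [|k'] kn' c0.
    by rewrite !bin0 divr1 /= addr0.
  rewrite mulr1n -mulrDl /= -natrD.
  by case: (n) n0 c0 => // n' _ c0; rewrite -binS divff.
rewrite [leLHS]big_mkcond [leRHS]big_mkcond /=; apply: ler_sum => A _.
case: ifPn => [Ai|_]; last by case: ifP => // _; apply: unif_ge0.
suff -> : isolating x v A by [].
rewrite /isolating (negbTE vC) /=; apply/forallP => j; apply/implyP => /andP[jl jC].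
have -> : j = i.
  apply/eqP/negPn/negP => ji; have /subcubeP/(_ j jl) := iC; have /subcubeP/(_ j jl) := jC.
  by rewrite !ffunE eqxx (negbTE ji) addbF => <-; case: (v j).
by apply: contraL Ai => iA; apply/subsetPn; exists i; rewrite // !inE eqxx.
Qed.

(** At every vertex at least one of the two conditions is void, hence has probability 1. *)
Lemma isolated_independent x y : [disjoint block x & block y] ->
  Pr (fun=> unif R k) (fun D => isolated x D && isolated y D) =
  Pr (fun=> unif R k) (isolated x) * Pr (fun=> unif R k) (isolated y).
Proof.
move=> dis; rewrite !Pr_forall -big_split /=.
transitivity (Pr (fun=> unif R k)
   (fun D => [forall v, isolating x v (D v) && isolating y v (D v)])).
  apply: eq_bigl => D; apply/andP/forallP => [[/forallP h1 /forallP h2] v|h].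
    by rewrite h1 h2.
  by split; apply/forallP => v; case/andP: (h v).
rewrite (Pr_forall _ (fun v A => isolating x v A && isolating y v A)).
apply: eq_bigr => v _.
have T z : v \notin block z -> \sum_(A | isolating z v A) unif R k A = 1.
  move=> vz; rewrite (eq_bigl predT); first by rewrite sum_unifT // ltnW.
  by move=> A; apply: isolatingT.
have [vx|vx] := boolP (v \in block x).
  have vy := disjointFr dis vx; rewrite (T y) ?vy // mulr1.
  by apply: eq_bigl => A; rewrite (isolatingT A (negbT vy)) andbT.
by rewrite (T x) // mul1r; apply: eq_bigl => A; rewrite (isolatingT A vx).
Qed.

(** The events are indexed by all vertices [x], so each subcube occurs once for each of its
    vertices; these repetitions are among the pairs that [card_meeting] counts. *)
Lemma kout_disconnected_ge : 0 < isolation_prob ->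
  1 - ((n.+1 * 2 ^ k) ^ 2)%:R / ((2 ^ n)%:R * isolation_prob) <=
  kout_prob R n k (fun E => ~~ gconnected E).
Proof.
move=> p0; rewrite kout_probE.
have u0 (v : V) A : 0 <= unif R k A by apply: unif_ge0.
have u1 (v : V) : \sum_(A : {set 'I_n}) unif R k A = 1 by rewrite sum_unifT // ltnW.
rewrite PrC // lerD2l lerN2.
have T0 : (0 < #|V|)%N by rewrite card_cube expn_gt0.
have hf x y : [disjoint block x & block y] ->
  Pr (fun=> unif R k) (fun D => isolated x D && isolated y D) <=
  Pr (fun=> unif R k) (isolated x) * Pr (fun=> unif R k) (isolated y).
  by move=> /isolated_independent ->.
have := second_moment u0 u1 p0 T0 Pr_isolated_ge hf card_meeting.
rewrite card_cube; apply: le_trans.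
apply: le_Pr => // D _; apply: contraL => /existsP[x].
exact: isolated_disconnected.
Qed.

End IsolatedSubcubes.

(** * Small components *)

Section SmallComponents.
Variables (R : realType) (n : nat).
Notation V := (cube n).
Notation config := {ffun V -> {set 'I_n}}.
Implicit Types (x y u v : V) (i j : 'I_n) (A : {set 'I_n}) (S W X : {set V}) (D : config).

(** Each factor [(m - i) / (n - i)] of the quotient of falling factorials is at most [m / n]. *)
Lemma bin_ratio_le (m k : nat) : (m <= n)%N -> (0 < n)%N -> (k <= n)%N ->
  'C(m, k)%:R / 'C(n, k)%:R <= (m%:R / n%:R) ^+ k :> R.
Proof.
move=> mn n0 kn.
have c0 : (0 < 'C(n, k))%N by rewrite bin_gt0.
rewrite ler_pdivrMr ?ltr0n // expr_div_n mulrAC ler_pdivlMr ?exprn_gt0 ?ltr0n //.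
rewrite -!natrX -!natrM ler_nat -(leq_pmul2r (fact_gt0 k)).
rewrite mulnAC bin_ffact -mulnA bin_ffact.
elim: k {kn c0} => [|k IH]; first by rewrite !ffactn0.
rewrite !ffactnSr !expnSr.
rewrite mulnACA [leqRHS]mulnACA; apply: leq_mul => //.
by rewrite mulnBl mulnBr leq_sub2l // [(m * k)%N]mulnC leq_mul2l mn orbT.
Qed.

Definition inward (S W : {set V}) D : bool :=
  [forall v in S, D v \subset dirs W v].

Lemma Pr_inward (k : nat) S W : (k <= n)%N ->
  Pr (fun=> unif R k) (inward S W) =
  \prod_(v in S) ('C(#|dirs W v|, k)%:R / 'C(n, k)%:R).
Proof.
move=> kn; rewrite (Pr_forall _ (fun v A => (v \in S) ==> (A \subset dirs W v))).
rewrite [RHS]big_mkcond; apply: eq_bigr => v _; case: ifP => vS /=.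
  exact: sum_unif.
by rewrite sum_unifT.
Qed.

Lemma log2_nat_ge0 (m : nat) : 0 <= log2 m%:R :> R.
Proof.
apply: divr_ge0; last exact: ltW (ln2_gt0 R).
by case: m => [|m]; [rewrite ln0 | rewrite ln_ge0 // ler1n].
Qed.

Lemma sum_dirs_le S W : S \subset W ->
  (\sum_(v in S) #|dirs W v|)%:R <= #|W|%:R * log2 #|W|%:R :> R.
Proof.
move=> SW; rewrite /log2 mulrA ler_pdivlMr ?ln2_gt0 //.
apply: le_trans (edge_isoperimetry R W); apply: ler_wpM2r; first exact: ltW (ln2_gt0 R).
rewrite ler_nat [leqRHS](bigID (mem S)) /=
  [X in (_ <= X + _)%N](_ : _ = \sum_(v in S) #|dirs W v|)%N.
  exact: leq_addr.
by apply: eq_bigl => v; rewrite andbC; case vS : (v \in S); rewrite // (subsetP SW).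
Qed.

(** The choices in [S] are independent, and a vertex of degree [d] into [W] contributes at most
    [(d / n) ^+ k]. The AM-GM inequality reduces the product to the sum of the degrees, which
    isoperimetry bounds. *)
Lemma Pr_inward_le (k : nat) S W : (k <= n)%N -> (0 < n)%N -> S \subset W ->
  Pr (fun=> unif R k) (inward S W) <=
  (#|W|%:R * log2 #|W|%:R / (#|S|%:R * n%:R)) ^+ (k * #|S|).
Proof.
move=> kn n0 SW; rewrite Pr_inward //.
have [->|S0] := eqVneq S set0; first by rewrite big_set0 cards0 muln0 expr0.
have s0 : (0 < #|S|)%N by rewrite card_gt0.
have r0 : 0 <= #|W|%:R * log2 #|W|%:R / (#|S|%:R * n%:R) :> R.
  by rewrite divr_ge0 // mulr_ge0 // log2_nat_ge0.
apply: (@le_trans _ _ (\prod_(v in S) (#|dirs W v|%:R / n%:R) ^+ k)).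
  apply: ler_prod => v _; rewrite divr_ge0 //=; apply: bin_ratio_le => //.
  exact: card_dirs_le.
rewrite prodrXl mulnC exprM; apply: lerXn2r; rewrite ?nnegrE.
- by apply: prodr_ge0 => v _; rewrite divr_ge0.
- by apply: exprn_ge0.
have [] := @leif_AGM R V (mem S) (fun v => #|dirs W v|%:R / n%:R).
  by move=> v _; rewrite divr_ge0.
move=> h _; apply: le_trans h _; apply: lerXn2r; rewrite ?nnegrE.
- by rewrite divr_ge0 // sumr_ge0 // => v _; rewrite divr_ge0.
- by [].
rewrite -mulr_suml -natr_sum invfM mulrA mulrAC ler_pM2r ?invr_gt0 ?ltr0n //.
by rewrite ler_pM2r ?invr_gt0 ?ltr0n // sum_dirs_le.
Qed.

(** If a vertex of [S] has fewer than [k] neighbours in [S :|: X], the event is impossible.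
    Otherwise all these degrees are at least [k], which yields the two lower bounds that the
    numerical estimate may assume. *)
Lemma Pr_separated_le (k : nat) S X (b : R) :
  (k <= n)%N -> (0 < n)%N -> S != set0 -> (#|X| < k)%N -> 0 <= b ->
  (let w := #|S :|: X| in (k <= 2 * #|S|)%N -> (k * #|S|)%:R <= w%:R * log2 w%:R :> R ->
     (w%:R * log2 w%:R / (#|S|%:R * n%:R)) ^+ (k * #|S|) <= b) ->
  Pr (fun=> unif R k) (inward S (S :|: X)) <= b.
Proof.
move=> kn n0 S0 Xk b0 hb; have SW : S \subset S :|: X by apply: subsetUl.
have [/forall_inP h|/forall_inPn[v vS hv]] :=
  boolP [forall v in S, k <= #|dirs (S :|: X) v|]%N; last first.
  rewrite Pr_inward // (bigD1 v) //= bin_small ?mul0r //.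
  by rewrite ltnNge.
apply: le_trans (Pr_inward_le kn n0 SW) _; apply: hb.
- by case/set0Pn: S0 => v vS; apply: (card_separated (v := v) (X := X)).
apply: le_trans (sum_dirs_le SW); rewrite ler_nat mulnC -sum_nat_const.
exact: leq_sum.
Qed.

Definition nb S : {set V} := \bigcup_(v in S) [set flip v i | i in 'I_n].

Lemma card_nb S : (#|nb S| <= #|S| * n)%N.
Proof.
apply: (@leq_trans (\sum_(v in S) #|[set flip v i | i in 'I_n]|)%N).
  rewrite /nb; elim/big_ind2: _ => [|a A b B ha hb|//]; first by rewrite cards0.
  by apply: leq_trans (leq_card_setU _ _) (leq_add ha hb).
rewrite -sum_nat_const; apply: leq_sum => v _.
by apply: leq_trans (leq_imset_card _ _) _; rewrite card_ord.
Qed.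

Lemma bin_le_expn (m k : nat) : ('C(m, k) <= m ^ k)%N.
Proof.
apply: (@leq_trans (m ^_ k)); first by rewrite -bin_ffact leq_pmulr ?fact_gt0.
by elim: k => [|k IH]; rewrite ?ffactn0 // ffactnSr expnSr leq_mul ?leq_subr.
Qed.

Lemma card_small_subsets (T : finType) (Y : {set T}) (k : nat) :
  (#|[set X : {set T} | X \subset Y & (#|X| < k)%N]| <= (#|Y|.+1) ^ k)%N.
Proof.
case: k => [|k].
  by rewrite eq_card0 // => X; rewrite !inE ltn0 andbF.
elim: k => [|k IH].
  rewrite expn1; apply: (@leq_trans #|[set (set0 : {set T})]|); last by rewrite cards1.
  apply: subset_leq_card.
  by apply/subsetP => X; rewrite !inE ltnS leqn0 cards_eq0 => /andP[].
move: IH; set k1 := k.+1 => IH.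
rewrite (_ : [set X : {set T} | X \subset Y & (#|X| < k1.+1)%N] =
  [set X : {set T} | X \subset Y & (#|X| < k1)%N] :|:
  [set X : {set T} | X \subset Y & #|X| == k1]); last first.
  by apply/setP => X; rewrite !inE -andb_orr ltnS leq_eqVlt orbC.
apply: leq_trans (leq_card_setU _ _) _; rewrite expnSr mulnS.
apply: leq_add => //; rewrite cards_draws.
apply: leq_trans (bin_le_expn _ _) _; rewrite /k1 expnS mulnC.
rewrite leq_mul2r; apply/orP; right.
apply: (@leq_trans (#|Y|.+1 ^ k)%N); last by rewrite leq_pexp2l.
by case: (k) => // k'; rewrite leq_exp2r.
Qed.

(** Only the part of [X] adjacent to the component matters. With this restriction the number of sets
    [X] to consider depends on the size of the component and not on that of the cube. *)
Lemma inward_comp D X x : x \notin X ->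
  inward (comp D (~: X) x) (comp D (~: X) x :|: (X :&: nb (comp D (~: X) x))) D.
Proof.
move=> xX; apply/forall_inP => v vC; apply/subsetP => i iD.
rewrite inE in_setU in_setI; have [fX|fX] := boolP (flip v i \in X).
  rewrite orbC /=; apply/orP; left; apply/bigcupP; exists v => //.
  by apply/imsetP; exists i.
apply/orP; left; apply: (comp_closed vC); rewrite /adjIn /= !inE fX.
have xcX : x \in ~: X by rewrite inE.
have := subsetP (comp_sub D xcX) _ vC; rewrite inE => -> /=.
by apply/adjDP; exists i; rewrite ?iD.
Qed.

(** Union bound over the pairs of a connected set [S] and a set of fewer than [k] of its neighbours,
    grouped by [s = #|S|]. The function [b] is left open so that the numerical estimates stay
    separate. *)
Lemma Pr_small_component_le (k m : nat) (b : nat -> R) :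
  (k <= n)%N -> (0 < n)%N -> (forall s, 0 <= b s) ->
  (forall s w : nat, (0 < s <= m)%N -> (s <= w < s + k)%N -> (k <= 2 * s)%N ->
     (k * s)%:R <= w%:R * log2 w%:R :> R ->
     (w%:R * log2 w%:R / (s%:R * n%:R)) ^+ (k * s) <= b s) ->
  Pr (fun=> unif R k) (fun D => [exists X : {set V}, exists x : V,
     [&& (#|X| < k)%N, x \notin X & (#|comp D (~: X) x| <= m)%N]]) <=
  \sum_(1 <= s < m.+1) (2 ^ n * n ^ (2 * s) * (s * n).+1 ^ k)%:R * b s.
Proof.
move=> kn n0 b0 hb.
pose Q (p : {set V} * {set V}) := [&& conn p.1, (0 < #|p.1| <= m)%N,
  p.2 \subset nb p.1 & (#|p.2| < k)%N].
apply: (@le_trans _ _ (\sum_(p | Q p) Pr (fun=> unif R k) (inward p.1 (p.1 :|: p.2)))).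
  apply: Pr_union => [v A|D /existsP[X /existsP[x /and3P[Xk xX cm]]]].
    exact: unif_ge0.
  exists (comp D (~: X) x, X :&: nb (comp D (~: X) x)); last exact: inward_comp.
  rewrite /Q /= conn_comp cm subsetIr card_gt0 andbT /=.
  apply/andP; split; first by apply/set0Pn; exists x; apply: comp_refl.
  by apply: leq_ltn_trans Xk; rewrite subset_leq_card // subsetIl.
apply: (@le_trans _ _ (\sum_(p | Q p) b #|p.1|)).
  apply: ler_sum => -[S X] /and4P[/= _ /andP[s0 sm] _ Xk].
  apply: Pr_separated_le => //; first by rewrite -card_gt0.
  apply: hb; first by rewrite s0.
  rewrite subset_leq_card ?subsetUl //=; apply: leq_ltn_trans (leq_card_setU _ _) _.
  by rewrite ltn_add2l.
rewrite (eq_bigl (fun p : {set V} * {set V} => (conn p.1 && (0 < #|p.1| <= m)%N) &&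
   ((p.2 \subset nb p.1) && (#|p.2| < k)%N))); last first.
  by move=> p; rewrite /Q -!andbA.
rewrite -(pair_big_dep (fun S => conn S && (0 < #|S| <= m)%N)
  (fun S X => (X \subset nb S) && (#|X| < k)%N) (fun S X => b #|S|)) /=.
apply: (@le_trans _ _ (\sum_(S | conn S && (0 < #|S| <= m)%N)
    ((#|S| * n).+1 ^ k)%:R * b #|S|)).
  apply: ler_sum => S _; rewrite sumr_const -[leLHS]mulr_natl.
  apply: ler_wpM2r => //; rewrite ler_nat -cardsE.
  apply: leq_trans (card_small_subsets _ _) _.
  by case: (k) => // k'; rewrite leq_exp2r // ltnS card_nb.
pose G s := ((s * n).+1 ^ k)%:R * b s.
have G0 s : 0 <= G s by rewrite mulr_ge0.
(* The term of [S] is written as a sum over the single index [s == #|S|], so that exchanging the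
   sums groups the sets by size. *)
apply: (@le_trans _ _ (\sum_(S : {set V} | conn S) \sum_(1 <= s < m.+1 | s == #|S|) G s)).
  rewrite [leLHS]big_mkcondr /=; apply: ler_sum => S _.
  by rewrite big_nat1_eq ltnS.
rewrite (eq_bigr (fun S : {set V} => \sum_(1 <= s < m.+1) if s == #|S| then G s else 0));
  last first.
  by move=> S _; rewrite big_mkcond.
rewrite exchange_big /=; apply: ler_sum => s _.
rewrite -big_mkcondr /= sumr_const -[leLHS]mulr_natl natrM -mulrA -/(G s).
apply: ler_wpM2r => //; rewrite ler_nat; apply: leq_trans (card_conn s n0).
by apply: subset_leq_card; apply/subsetP => S; rewrite inE eq_sym.
Qed.

End SmallComponents.

(** * Revealing one choice per vertex last *)

Section TwoRounds.
Variables (R : realType) (n j : nat).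
Hypothesis jn : (j < n)%N.
Notation V := (cube n).
Notation config := {ffun V -> {set 'I_n}}.
Implicit Types (x u v : V) (i : 'I_n) (A J K : {set 'I_n}) (S W X T : {set V}) (c D : config).

(** The law of the choice revealed last: uniform on the directions outside [J]. *)
Definition extra J i : R := if i \in J then 0 else (n - j)%:R^-1.

Lemma extra_ge0 J i : 0 <= extra J i.
Proof. by rewrite /extra; case: ifP => // _; rewrite invr_ge0. Qed.

(** A set [K] of size [j.+1] arises from [j.+1] pairs, one for each element that can come last, and
    ['C(n, j.+1) * j.+1 = 'C(n, j) * (n - j)]. *)
Lemma unif_extra K :
  unif R j.+1 K = \sum_(w : {set 'I_n} * 'I_n | w.2 |: w.1 == K) unif R j w.1 * extra w.1 w.2.
Proof.
transitivity (\sum_(i in K) unif R j (K :\ i) * (n - j)%:R^-1).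
  rewrite /unif; case: eqP => [cK|cK]; last first.
    rewrite big1 // => i iK; case: eqP => [cKi|]; last by rewrite mul0r.
    by case: cK; rewrite (cardsD1 i) iK cKi.
  rewrite (eq_bigr (fun=> 'C(n, j)%:R^-1 * (n - j)%:R^-1)); last first.
    move=> i iK; case: eqP => // cKi; case: cKi.
    by move: cK; rewrite (cardsD1 i) iK add1n => -[].
  rewrite sumr_const cK -invfM -natrM [(_ * (n - j))%N]mulnC -mul_bin_left natrM.
  by rewrite invfM -[LHS]mul1r -mulrnAl -[_^-1 *+ _]mulr_natl divff ?pnatr_eq0.
rewrite big_mkcond /=.
transitivity (\sum_(i : 'I_n) \sum_(J : {set 'I_n} | i |: J == K) unif R j J * extra J i).
  apply: eq_bigr => i _; case: ifPn => iK.
    rewrite (bigD1 (K :\ i)) ?setD1K //= /extra setD11 big1 ?addr0 // => J /andP[/eqP e ne].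
    case: ifPn => iJ; first by rewrite mulr0.
    by case/eqP: ne; rewrite -e setU1K.
  rewrite big1 // => J /eqP e; by rewrite -e setU11 in iK.
rewrite (exchange_big_dep predT) //= pair_big_dep /=.
by apply: eq_bigl => -[J i].
Qed.

Lemma Pr_two_rounds (A : pred config) :
  Pr (fun=> unif R j.+1) A =
  \sum_(c : config) (\prod_v unif R j (c v)) *
    Pr (fun v => extra (c v)) (fun e => A [ffun v => e v |: c v]).
Proof.
rewrite (Pr_push (phi := fun _ w => w.2 |: w.1)
  (nu := fun _ w => unif R j w.1 * extra w.1 w.2)); last first.
  by move=> v K; apply: unif_extra.
rewrite (Pr_prod (fun _ J => unif R j J) (fun _ J i => extra J i)).
apply: eq_bigr => c _; congr (_ * _); apply: eq_bigl => e.
by congr A; apply/ffunP => v; rewrite !ffunE.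
Qed.

Definition small (M : nat) D : {set V} := [set v | #|comp D setT v| <= M]%N.

Lemma comp_setT_inward D x : inward (comp D setT x) (comp D setT x :|: set0) D.
Proof.
apply/forall_inP => v vC; apply/subsetP => i iD; rewrite setU0 inE.
apply: (comp_closed vC); rewrite /adjIn /= !inE /=.
by apply/adjDP; exists i; rewrite ?iD.
Qed.

(** Markov's inequality for the number of vertices in components of size at most [M]. A component of
    size [s] is counted by each of its vertices, whence the additional factor [s]. *)
Lemma Pr_many_small_le (M z : nat) (b : nat -> R) : (0 < j)%N ->
  (forall s, 0 <= b s) ->
  (forall s : nat, (0 < s <= M)%N -> (j * s)%:R <= s%:R * log2 s%:R :> R ->
     (s%:R * log2 s%:R / (s%:R * n%:R)) ^+ (j * s) <= b s) ->
  Pr (fun=> unif R j) (fun D => z < #|small M D|)%N <=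
  (\sum_(1 <= s < M.+1) (2 ^ n * n ^ (2 * s) * s)%:R * b s) / z.+1%:R.
Proof.
move=> j0 b0 hb; have n0 : (0 < n)%N by case: (n) jn.
have u0 (v : V) A : 0 <= unif R j A by apply: unif_ge0.
rewrite ler_pdivlMr ?ltr0n //.
apply: (@le_trans _ _ (\sum_v Pr (fun=> unif R j) (fun D => v \in small M D))).
  rewrite PrE; under [leRHS]eq_bigr do rewrite PrE.
  rewrite exchange_big /= mulr_suml; apply: ler_sum => D _.
  rewrite -mulr_suml mulrAC; apply: ler_wpM2r; first by apply: prodr_ge0 => v _; apply: unif_ge0.
  rewrite -natr_sum -natrM ler_nat.
  rewrite (_ : \sum_(i : V) _ = #|small M D|)%N; last by rewrite -big_mkcond /= sum1_card.
  by case: ltnP => // h; rewrite mul1n.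
pose Q S := conn S && (0 < #|S| <= M)%N.
apply: (@le_trans _ _ (\sum_v \sum_(S | Q S && (v \in S)) b #|S|)).
  apply: ler_sum => v _.
  apply: (@le_trans _ _ (\sum_(S | Q S && (v \in S)) Pr (fun=> unif R j) (inward S (S :|: set0)))).
    apply: Pr_union => // D; rewrite inE => h.
    exists (comp D setT v); last exact: comp_setT_inward.
    rewrite /Q conn_comp h comp_refl !andbT /= card_gt0.
    by apply/set0Pn; exists v; apply: comp_refl.
  apply: ler_sum => S /andP[/andP[_ /andP[s0 sm]] _].
  apply: Pr_separated_le => //; rewrite ?(ltnW jn) ?cards0 // -?card_gt0 //.
  by rewrite setU0 => w _; apply: hb; rewrite s0.
rewrite (exchange_big_dep Q) /=; last by move=> v S _ /andP[].
pose G s := s%:R * b s.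
have G0 s : 0 <= G s by rewrite mulr_ge0.
rewrite (eq_bigr (fun S => G #|S|)); last first.
  move=> S QS; rewrite (eq_bigl (mem S)); last by move=> v; rewrite /= QS.
  by rewrite sumr_const /G mulr_natl.
apply: (@le_trans _ _ (\sum_(S : {set V} | conn S) \sum_(1 <= s < M.+1 | s == #|S|) G s)).
  rewrite [leLHS]big_mkcondr /=; apply: ler_sum => S _.
  by rewrite big_nat1_eq ltnS.
rewrite (eq_bigr (fun S : {set V} => \sum_(1 <= s < M.+1) if s == #|S| then G s else 0));
  last first.
  by move=> S _; rewrite big_mkcond.
rewrite exchange_big /=; apply: ler_sum => s _.
rewrite -big_mkcondr /= sumr_const -[leLHS]mulr_natl natrM -mulrA -/(G s).
apply: ler_wpM2r => //; rewrite ler_nat; apply: leq_trans (card_conn s n0).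
by apply: subset_leq_card; apply/subsetP => S; rewrite inE eq_sym.
Qed.

(** [S] is a union of components of the graph without [X]. *)
Definition saturated D X S : bool :=
  (S \subset ~: X) && [forall u in S, forall v, adjIn D (~: X) u v ==> (v \in S)].

Lemma saturatedP D X S : reflect (S \subset ~: X /\
  forall u v, u \in S -> adjIn D (~: X) u v -> v \in S) (saturated D X S).
Proof.
apply: (iffP andP) => -[SX h]; split => //.
  by move=> u v uS uv; move/forall_inP/(_ u uS)/forallP/(_ v): h; rewrite uv.
by apply/forall_inP => u uS; apply/forallP => v; apply/implyP => /(h _ _ uS).
Qed.

Lemma saturated_comp D X x : x \notin X -> saturated D X (comp D (~: X) x).
Proof.
move=> xX; apply/saturatedP; split; first by apply: comp_sub; rewrite inE.
by move=> u v; apply: comp_closed.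
Qed.

Lemma saturated_sub D X S x : saturated D X S -> x \in S -> comp D (~: X) x \subset S.
Proof.
move=> /saturatedP[_ h] xS; apply/subsetP => y; rewrite inE => /connect_closed.
by apply.
Qed.

Definition fragment (M : nat) D X : {set V} :=
  [set v in ~: X | #|comp D (~: X) v| <= M]%N.

(** A component outside [X] with no edge to [X] is a component of the whole graph. Every other one
    contains a cube neighbour of [X], so at most [#|X| * n] of them arise, each of size at most [M]
    if it is counted here. *)
Lemma card_fragment (M : nat) D X :
  (#|fragment M D X| <= #|small M D| + #|X| * (n * M))%N.
Proof.
pose near (p : V * 'I_n) := let C := comp D (~: X) (flip p.1 p.2) in
  if (#|C| <= M)%N then C else set0.
apply: (@leq_trans #|small M D :|: \bigcup_(p | p.1 \in X) near p|).
  apply: subset_leq_card; apply/subsetP => v; rewrite 2!inE => /andP[vX cv].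
  rewrite in_setU; apply/orP.
  have [/exists_inP[u uC /exists_inP[x xX ux]]|/exists_inPn h] :=
    boolP [exists u in comp D (~: X) v, exists x in X, adjD D u x].
    right; move: ux; rewrite adjD_sym => /adjDP[i eu _].
    apply/bigcupP; exists (x, i) => //; rewrite /near /= -eu (comp_eq uC) cv.
    exact: comp_refl.
  left; rewrite inE; apply: leq_trans cv; apply: subset_leq_card.
  apply/subsetP => y; rewrite inE => /connect_closed; apply; last exact: comp_refl.
  move=> u w uC /and3P[_ _ uw]; apply: (comp_closed uC).
  rewrite /adjIn /= uw andbT; apply/andP; split.
    have vX' : v \in ~: X by rewrite inE.
    exact: subsetP (comp_sub D vX') _ uC.
  rewrite inE; apply: contraT; rewrite negbK => wX.
  by have /exists_inPn/(_ w wX) := h u uC; rewrite uw.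
apply: leq_trans (leq_card_setU _ _) _; rewrite leq_add2l.
apply: (@leq_trans (\sum_(p : V * 'I_n | p.1 \in X) M)%N).
  apply: (@leq_trans (\sum_(p : V * 'I_n | p.1 \in X) #|near p|)%N).
    elim/big_ind2: _ => [|a B b C ha hb|//]; first by rewrite cards0.
    by apply: leq_trans (leq_card_setU _ _) (leq_add ha hb).
  by apply: leq_sum => p _; rewrite /near; case: ifP => //; rewrite cards0.
rewrite sum_nat_const mulnA leq_mul2r; apply/orP; right.
rewrite (_ : #|_| = #|setX X [set: 'I_n]|); first by rewrite cardsX cardsT card_ord.
by apply: eq_card => -[x i]; rewrite !inE /= andbT.
Qed.

(** [S] is determined by its trace on the small components, an arbitrary subset of [fragment M D X],
    and by one root in each of its other components. The latter have more than [M] vertices each, so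
    there are at most [s %/ M.+1] of them. *)
Lemma card_saturated (M s : nat) D X :
  (#|[set S | saturated D X S & #|S| == s]| <=
   2 ^ #|fragment M D X| * (2 ^ n).+1 ^ (s %/ M.+1).+1)%N.
Proof.
pose U := fragment M D X; pose q := (s %/ M.+1)%N.
pose f (p : {set V} * {set V}) := p.1 :|: \bigcup_(x in p.2) comp D (~: X) x.
pose dom := setX (powerset U) [set Y : {set V} | Y \subset setT & #|Y| < q.+1]%N.
apply: (@leq_trans #|dom|); last first.
  rewrite cardsX card_powerset leq_mul2l; apply/orP; right.
  by rewrite -card_cube -cardsT card_small_subsets.
apply: leq_trans (leq_imset_card f dom); apply: subset_leq_card.
apply/subsetP => S; rewrite inE => /andP[sS /eqP cS].
pose rt := fingraph.root (adjIn D (~: X)).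
have rtC x : rt x \in comp D (~: X) x by rewrite inE connect_root.
pose Y := rt @: (S :\: U).
have cl x : x \in S -> comp D (~: X) x \subset S by apply: saturated_sub.
have YS y : y \in Y -> [/\ y \in S, (M < #|comp D (~: X) y|)%N & rt y = y].
  case/imsetP => x; rewrite inE => /andP[xU xS] ->; split.
  - exact: subsetP (cl x xS) _ (rtC x).
  - rewrite (comp_eq (rtC x)) ltnNge; apply: contra xU => h.
    have /saturatedP[/subsetP/(_ x xS) xX _] := sS.
    by rewrite inE xX.
  - by rewrite /rt root_root //; apply/sym_connect_sym/adjIn_sym.
apply/imsetP; exists (S :&: U, Y).
  rewrite in_setX powersetE subsetIr inE subsetT ltnS /= /q leq_divRL //.
  rewrite -cS -sum_nat_const.
  apply: (@leq_trans (\sum_(y in Y) #|comp D (~: X) y|)%N).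
    by apply: leq_sum => y /YS[].
  rewrite (eq_bigr (fun y => \sum_(v in comp D (~: X) y) 1)%N); last first.
    by move=> y _; rewrite sum1_card.
  rewrite (exchange_big_dep (mem S)) /=; last first.
    by move=> y v /YS[yS _ _]; apply: subsetP (cl y yS) v.
  (* The components of distinct roots are disjoint, so each [v] of [S] is counted at most once. *)
  rewrite -sum1_card; apply: leq_sum => v _; rewrite sum1_card.
  have symD : connect_sym (adjIn D (~: X)) by apply/sym_connect_sym/adjIn_sym.
  have rtv y : y \in Y -> v \in comp D (~: X) y -> y = rt v.
    move=> /YS[_ _ e]; rewrite inE => /(fingraph.rootP symD) e2.
    by rewrite -[LHS]e.
  apply/card_le1_eqP => y y' hy hy'.
  have [yY vy] := andP hy; have [yY' vy'] := andP hy'.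
  by rewrite [LHS](rtv y' yY' vy') [RHS](rtv y yY vy).
apply/eqP; rewrite eqEsubset; apply/andP; split; apply/subsetP => x.
  move=> xS; rewrite in_setU in_setI xS /=.
  have [//|xU] := boolP (x \in U); apply/bigcupP; exists (rt x).
    by apply: imset_f; rewrite inE xU.
  by rewrite (comp_eq (rtC x)) comp_refl.
rewrite in_setU in_setI => /orP[/andP[]//|/bigcupP[y /YS[yS _ _]]].
exact: subsetP (cl y yS) x.
Qed.

End TwoRounds.

(** * Large components, and the bound that combines all cases *)

Section LargeComponents.
Variables (R : realType) (n j : nat).
Hypothesis jn : (j < n)%N.
Notation V := (cube n).
Notation config := {ffun V -> {set 'I_n}}.
Implicit Types (x u v : V) (i : 'I_n) (A J K : {set 'I_n}) (S W X T : {set V}) (c D : config).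

Definition crossing S X : {set V} := [set v in S | dirs (~: (S :|: X)) v != set0].

(** As [S] fills at most half of the cube, isoperimetry gives an inner degree sum of at most
    [#|S| * n.-1], so at least [#|S|] edges leave [S]. At most [n * #|X|] of them end in [X], and
    each crossing vertex carries at most [n] of the others. *)
Lemma card_crossing S X : (2 * #|S| <= 2 ^ n)%N ->
  (#|S| <= n * #|crossing S X| + n * #|X|)%N.
Proof.
have n0 : (0 < n)%N by case: (n) jn.
have [->|S0] := eqVneq S set0; first by rewrite cards0.
have s0 : (0 < #|S|)%N by rewrite card_gt0.
move=> S2; pose T := ~: (S :|: X).
have hS : (\sum_(v in S) #|dirs S v| <= #|S| * n.-1)%N.
  rewrite -(ler_nat R) -(ler_pM2r (ln2_gt0 R)); apply: le_trans (edge_isoperimetry R S) _.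
  rewrite natrM -mulrA ler_pM2l ?ltr0n // mulr_natl -lnXn // ler_ln ?posrE ?ltr0n ?exprn_gt0 //.
  rewrite -natrX ler_nat -(leq_pmul2l (isT : 0 < 2)%N); apply: leq_trans S2 _.
  by rewrite -expnS prednK.
have hX : (\sum_(v in S) #|dirs X v| <= n * #|X|)%N.
  apply: (@leq_trans (\sum_(i : 'I_n) #|X|)%N); last by rewrite sum_nat_const card_ord.
  rewrite (eq_bigr (fun v => \sum_(i : 'I_n | flip v i \in X) 1)%N); last first.
    by move=> v _; rewrite -sum1_card; apply: eq_bigl => i; rewrite inE.
  rewrite (exchange_big_dep predT) //=; apply: leq_sum => i _; rewrite sum1_card.
  rewrite -(card_imset _ (@flip_inj n i)); apply: subset_leq_card.
  by apply/subsetP => _ /imsetP[v /andP[_ +] ->].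
have hT : (\sum_(v in S) #|dirs T v| <= n * #|crossing S X|)%N.
  rewrite (bigID (fun v => dirs T v != set0)) /= [X in (_ + X)%N]big1 ?addn0; last first.
    by move=> v /andP[_]; rewrite negbK => /eqP->; rewrite cards0.
  rewrite mulnC -sum_nat_const [leqRHS](eq_bigl (fun v => (v \in S) && (dirs T v != set0))).
    by apply: leq_sum => v _; apply: card_dirs_le.
  by move=> v; rewrite inE.
have hn : (#|S| * n <= \sum_(v in S) (#|dirs S v| + #|dirs X v| + #|dirs T v|))%N.
  rewrite -sum_nat_const; apply: leq_sum => v _.
  rewrite -[leqLHS](card_ord n) -cardsT.
  rewrite (_ : [set: _] = dirs S v :|: dirs X v :|: dirs T v).
    by rewrite (leq_trans (leq_card_setU _ _)) // leq_add2r leq_card_setU.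
  by apply/setP => i; rewrite !inE negb_or; case: (_ \in S); case: (_ \in X).
move: hn; rewrite !big_split /=.
have -> : (#|S| * n = #|S| * n.-1 + #|S|)%N by rewrite -mulnSr prednK.
move: hS hX hT; move: (\sum_(v in S) #|dirs S v|)%N (\sum_(v in S) #|dirs X v|)%N.
move: (\sum_(v in S) #|dirs T v|)%N (#|S| * n.-1)%N (n * #|X|)%N (n * #|crossing S X|)%N.
by move: #|S| => s; clear; lia.
Qed.

Definition add_extra c (e : {ffun V -> 'I_n}) : config := [ffun v => e v |: c v].

Lemma sum_extra J : #|J| = j -> \sum_i extra R j J i = 1.
Proof.
move=> cJ; rewrite /extra (eq_bigr (fun i => if i \in ~: J then (n - j)%:R^-1 else 0)); last first.
  by move=> i _; rewrite inE if_neg.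
rewrite -big_mkcond sumr_const cardsCs setCK cJ card_ord -[LHS]mulr_natl divff //.
by rewrite pnatr_eq0 -lt0n subn_gt0.
Qed.

(** If [c] already chooses an edge from [S] to the outside of [S :|: X], the probability is 0.
    Otherwise the last choice at each crossing vertex independently avoids an outward direction,
    whose mass is [(n - j)%:R^-1], at least [n%:R^-1]. *)
Lemma Pr_extra_saturated c X S : (forall v, #|c v| = j) ->
  Pr (fun v => extra R j (c v)) (fun e => saturated (add_extra c e) X S) <=
  (1 - n%:R^-1) ^+ #|crossing S X|.
Proof.
move=> hc; have n0 : (0 < n)%N by case: (n) jn.
have b0 : 0 <= 1 - n%:R^-1 :> R by rewrite subr_ge0 invf_le1 ?ler1n ?ltr0n.
pose T := ~: (S :|: X).
have out e v i : saturated (add_extra c e) X S -> v \in S -> i \in dirs T v -> i \notin e v |: c v.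
  move=> /saturatedP[/subsetP SX sat] vS iT; apply/negP => ie.
  move: iT; rewrite !inE negb_or => /andP[/negP fS fX]; apply: fS.
  apply: (sat _ _ vS); apply/and3P; split; [exact: SX | by rewrite inE | ].
  by apply/adjDP; exists i; rewrite // !ffunE ie.
have [/exists_inP[v vS /exists_inP[i iT ic]]|/exists_inPn h] :=
  boolP [exists v in S, exists i in dirs T v, i \in c v].
  rewrite /Pr big_pred0 ?exprn_ge0 // => e; apply/negP => /(out _ v i)/(_ vS iT).
  by rewrite in_setU ic orbT.
apply: (@le_trans _ _ (Pr (fun v => extra R j (c v))
    (fun e => [forall v, (v \in S) ==> (e v \notin dirs T v)]))).
  apply: le_Pr => [v i|e _ sat]; first exact: extra_ge0.
  apply/forallP => v; apply/implyP => vS; apply/negP => iT.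
  by have := out e v _ sat vS iT; rewrite in_setU in_set1 eqxx.
rewrite (Pr_forall _ (fun v i => (v \in S) ==> (i \notin dirs T v))).
rewrite -prodr_const [leRHS]big_mkcond /=; apply: ler_prod => v _.
apply/andP; split; first by apply: sumr_ge0 => i _; apply: extra_ge0.
case: ifPn => [|_]; last first.
  rewrite -(sum_extra (hc v)) big_mkcond; apply: ler_sum => i _.
  by case: ifP => // _; apply: extra_ge0.
rewrite inE => /andP[vS /set0Pn[i0 i0T]].
have ic : i0 \notin c v by have /exists_inPn/(_ i0 i0T) := h v vS.
apply: (@le_trans _ _ (1 - extra R j (c v) i0)).
  rewrite lerBrDr -(sum_extra (hc v)) [leRHS](bigD1 i0) //= [leLHS]addrC lerD2l.
  rewrite vS /= [leLHS]big_mkcond [leRHS]big_mkcond; apply: ler_sum => i _.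
  case: ifPn => iT; last by case: ifP => // _; apply: extra_ge0.
  by rewrite (_ : i != i0) //; apply: contraNneq iT => ->.
rewrite /extra (negbTE ic) lerD2l lerN2 lef_pV2 ?posrE ?ltr0n ?subn_gt0 //.
by rewrite ler_nat leq_subr.
Qed.

(** Further choices only merge components. Hence the union bound over the last round may range over
    the unions of components of the first, which are few. *)
Lemma saturated_add_extra c e X S : saturated (add_extra c e) X S -> saturated c X S.
Proof.
move=> /saturatedP[SX h]; apply/saturatedP; split => // u v uS /and3P[uX vX /adjDP[i ev uv]].
apply: h uS _; rewrite /adjIn /= uX vX; apply/adjDP; exists i => //.
by rewrite !ffunE !in_setU; case/orP: uv => ->; rewrite !orbT.
Qed.

Lemma Pr_extra_large_le (k M z m : nat) (g : nat -> R) c :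
  (forall v, #|c v| = j) -> (forall s, 0 <= g s) ->
  (#|small M c| <= z)%N ->
  (forall s r : nat, (m < s)%N -> (s <= n * r + n * k)%N -> (1 - n%:R^-1) ^+ r <= g s) ->
  Pr (fun v => extra R j (c v)) (fun e => [exists X : {set V}, exists x : V,
     let C := comp (add_extra c e) (~: X) x in
     [&& (#|X| < k)%N, x \notin X, (m < #|C|)%N & (2 * #|C| <= 2 ^ n)%N]]) <=
  ((2 ^ n).+1 ^ k)%:R * \sum_(m.+1 <= s < (2 ^ n).+1)
     (2 ^ (z + k * (n * M)) * (2 ^ n).+1 ^ (s %/ M.+1).+1)%:R * g s.
Proof.
move=> hc g0 hz hg.
pose Q1 X := (#|X| < k)%N.
pose Q2 X S := [&& saturated c X S, (m < #|S|)%N & (2 * #|S| <= 2 ^ n)%N].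
apply: (@le_trans _ _ (\sum_(p : {set V} * {set V} | Q1 p.1 && Q2 p.1 p.2)
    Pr (fun v => extra R j (c v)) (fun e => saturated (add_extra c e) p.1 p.2))).
  apply: Pr_union => [v i|e /existsP[X /existsP[x /and4P[Xk xX mC C2]]]].
    exact: extra_ge0.
  exists (X, comp (add_extra c e) (~: X) x) => /=; last exact: saturated_comp.
  rewrite /Q1 /Q2 Xk mC C2 !andbT; apply: (saturated_add_extra (e := e)).
  exact: saturated_comp.
rewrite -(pair_big_dep Q1 Q2 (fun X S => Pr (fun v => extra R j (c v))
   (fun e => saturated (add_extra c e) X S))) /=.
pose H s : R := (2 ^ (z + k * (n * M)) * (2 ^ n).+1 ^ (s %/ M.+1).+1)%:R * g s.
apply: (@le_trans _ _ (\sum_(X | Q1 X) \sum_(m.+1 <= s < (2 ^ n).+1) H s)); last first.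
  rewrite sumr_const -[leLHS]mulr_natl; apply: ler_wpM2r.
    by apply: sumr_ge0 => s _; rewrite mulr_ge0.
  rewrite ler_nat -card_cube -cardsT; apply: leq_trans (card_small_subsets _ _).
  by apply: subset_leq_card; apply/subsetP => X; rewrite inE subsetT.
apply: ler_sum => X Xk.
apply: (@le_trans _ _ (\sum_(S | Q2 X S) g #|S|)).
  apply: ler_sum => S /and3P[sS mS S2].
  apply: le_trans (Pr_extra_saturated _ _ hc) _; apply: hg => //.
  apply: leq_trans (card_crossing X S2) _.
  by rewrite leq_add2l leq_mul2l (ltnW Xk) orbT.
apply: (@le_trans _ _ (\sum_(S | saturated c X S)
    \sum_(m.+1 <= s < (2 ^ n).+1 | s == #|S|) g s)).
  rewrite [leLHS]big_mkcondr /=; apply: ler_sum => S _.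
  rewrite big_nat1_eq ltnS -card_cube max_card andbT.
  by case: (m < #|S|)%N => //=; case: ifP.
rewrite (eq_bigr (fun S => \sum_(m.+1 <= s < (2 ^ n).+1) if s == #|S| then g s else 0)); last first.
  by move=> S _; rewrite big_mkcond.
rewrite exchange_big /=; apply: ler_sum => s _.
rewrite -big_mkcondr /= sumr_const -[leLHS]mulr_natl.
apply: ler_wpM2r => //; rewrite ler_nat.
apply: (@leq_trans #|[set S | saturated c X S & #|S| == s]|).
  by apply: subset_leq_card; apply/subsetP => S; rewrite inE eq_sym.
apply: leq_trans (card_saturated M s c X) _; rewrite leq_mul2r; apply/orP; right.
rewrite leq_exp2l //; apply: leq_trans (card_fragment M c X) _.
by rewrite leq_add // leq_mul2r (ltnW Xk) orbT.
Qed.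

(** The three error terms belong to a component of size at most [m], to more than [z] vertices in
    components of size at most [M] after [j] choices, and to a component of size above [m] when
    there are at most [z] such vertices. *)
Lemma kout_connected_ge (M z m : nat) (b1 b2 g : nat -> R) : (0 < j)%N -> (j.+1 < n)%N ->
  (forall s, 0 <= b1 s) -> (forall s, 0 <= b2 s) -> (forall s, 0 <= g s) ->
  (forall s w : nat, (0 < s <= m)%N -> (s <= w < s + j.+1)%N -> (j.+1 <= 2 * s)%N ->
     (j.+1 * s)%:R <= w%:R * log2 w%:R :> R ->
     (w%:R * log2 w%:R / (s%:R * n%:R)) ^+ (j.+1 * s) <= b1 s) ->
  (forall s : nat, (0 < s <= M)%N -> (j * s)%:R <= s%:R * log2 s%:R :> R ->
     (s%:R * log2 s%:R / (s%:R * n%:R)) ^+ (j * s) <= b2 s) ->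
  (forall s r : nat, (m < s)%N -> (s <= n * r + n * j.+1)%N -> (1 - n%:R^-1) ^+ r <= g s) ->
  1 - (\sum_(1 <= s < m.+1) (2 ^ n * n ^ (2 * s) * (s * n).+1 ^ j.+1)%:R * b1 s +
       (\sum_(1 <= s < M.+1) (2 ^ n * n ^ (2 * s) * s)%:R * b2 s) / z.+1%:R +
       ((2 ^ n).+1 ^ j.+1)%:R * \sum_(m.+1 <= s < (2 ^ n).+1)
         (2 ^ (z + j.+1 * (n * M)) * (2 ^ n).+1 ^ (s %/ M.+1).+1)%:R * g s)
  <= kout_prob R n j.+1 (fun E => kconnected E j.+1).
Proof.
move=> j0 jn1 b10 b20 g0 h1 h2 h3; rewrite kout_probE.
set e1 := \sum_(1 <= s < m.+1) _; set e2 := _ / z.+1%:R; set e3 := _ * \sum_(m.+1 <= s < _) _.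
have u0 k (v : V) A : 0 <= unif R k A by apply: unif_ge0.
have u1 (v : V) : \sum_(A : {set 'I_n}) unif R j.+1 A = 1 by rewrite sum_unifT.
have n0 : (0 < n)%N by case: (n) jn.
have -> : Pr (fun=> unif R j.+1) (fun D => kconnected (kgraph D) j.+1) =
  1 - Pr (fun=> unif R j.+1) (fun D => ~~ kconnected (kgraph D) j.+1).
  by rewrite PrC // subKr.
rewrite lerD2l lerN2.
pose Bad1 (D : config) := [exists X : {set V}, exists x : V,
     [&& (#|X| < j.+1)%N, x \notin X & (#|comp D (~: X) x| <= m)%N]].
pose Bad2 (D : config) := [exists X : {set V}, exists x : V,
     let C := comp D (~: X) x in
     [&& (#|X| < j.+1)%N, x \notin X, (m < #|C|)%N & (2 * #|C| <= 2 ^ n)%N]].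
have l2 : (j.+1 < 2 ^ n)%N by apply: leq_trans jn1 _; apply/ltnW/ltn_expl.
apply: (@le_trans _ _ (Pr (fun=> unif R j.+1) Bad1 + Pr (fun=> unif R j.+1) Bad2)).
  apply: (@le_trans _ _ (\sum_(t : bool) Pr (fun=> unif R j.+1) (if t then Bad1 else Bad2))).
    apply: Pr_union => [v A|D hD]; first exact: unif_ge0.
    have [X [x [Xk xX C2]]] := not_kconnected l2 hD.
    have [Cm|Cm] := leqP #|comp D (~: X) x| m.
      by exists true => //; apply/existsP; exists X; apply/existsP; exists x; apply/and3P.
    by exists false => //; apply/existsP; exists X; apply/existsP; exists x; apply/and4P.
  by rewrite big_bool.
rewrite -addrA; apply: lerD; first by apply: Pr_small_component_le; rewrite // ltnW.
rewrite Pr_two_rounds.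
pose w (c : config) : R := \prod_v unif R j (c v).
have w0 c : 0 <= w c by apply: prodr_ge0 => v _; apply: unif_ge0.
have W1 : \sum_c w c = 1.
  have h (v : V) : \sum_(A : {set 'I_n}) unif R j A = 1 by rewrite sum_unifT // ltnW.
  exact: (Pr_predT h).
have e30 : 0 <= e3.
  by apply: mulr_ge0 => //; apply: sumr_ge0 => s _; rewrite mulr_ge0.
(* Given the first round [c], the conditional probability is bounded by 1 if [c] has too many small
   components, and by [e3] otherwise. *)
apply: (@le_trans _ _ (\sum_c w c * ((z < #|small M c|)%N%:R + e3))); last first.
  rewrite (eq_bigr (fun c => (z < #|small M c|)%N%:R * w c + e3 * w c)); last first.
    by move=> c _; rewrite mulrDr ![w c * _]mulrC.
  rewrite big_split /= -mulr_sumr W1 mulr1 lerD2r.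
  by have := Pr_many_small_le jn z j0 b20 h2; rewrite PrE.
apply: ler_sum => c _; rewrite -/(w c).
have [/forallP hc|/forallPn[v hv]] := boolP [forall v, #|c v| == j]; last first.
  by rewrite /w (bigD1 v) //= {1 3}/unif (negbTE hv) !mul0r.
apply: ler_wpM2l => //; have hc' v : #|c v| = j by apply/eqP.
have ee0 (v : V) i : 0 <= extra R j (c v) i by apply: extra_ge0.
have [zc|zc] := ltnP z #|small M c|.
  apply: (@le_trans _ _ 1); last by rewrite lerDl.
  rewrite -(Pr_predT (fun v => sum_extra (hc' v))).
  by apply: le_Pr.
rewrite add0r; apply: Pr_extra_large_le => //.
Qed.

End LargeComponents.

(** * Estimates *)

Section Log2.
Variable R : realType.
Implicit Types (x y : R) (n k s w : nat).

Lemma ln2_lt1 : ln 2 < 1 :> R.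
Proof.
by rewrite -ltr_expR lnK ?posrE //; apply: le_lt_trans (expR_gt1Dx _); [lra | exact: oner_neq0].
Qed.

Lemma ln2_ge_half : 1 / 2 <= ln 2 :> R.
Proof.
have : ln (1 + - (1 / 2)) <= - (1 / 2) :> R by apply: le_ln1Dx; lra.
have -> : 1 + - (1 / 2) = 2^-1 :> R by field.
by rewrite lnV ?posrE //; lra.
Qed.

Lemma log2M x y : 0 < x -> 0 < y -> log2 (x * y) = log2 x + log2 y.
Proof. by move=> x0 y0; rewrite /log2 lnM ?posrE // mulrDl. Qed.

Lemma log2V x : 0 < x -> log2 x^-1 = - log2 x.
Proof. by move=> x0; rewrite /log2 lnV ?posrE // mulNr. Qed.

Lemma log2X x n : 0 < x -> log2 (x ^+ n) = n%:R * log2 x.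
Proof. by move=> x0; rewrite /log2 lnXn // mulr_natl mulrnAl. Qed.

Lemma log2_2 : log2 2 = 1 :> R.
Proof. by rewrite /log2 divff // gt_eqF // ln2_gt0. Qed.

Lemma log2_pow2 n : log2 (2 ^+ n) = n%:R :> R.
Proof. by rewrite log2X // log2_2 mulr1. Qed.

Lemma ler_log2 x y : 0 < x -> x <= y -> log2 x <= log2 y.
Proof.
move=> x0 xy; rewrite /log2 ler_pM2r ?invr_gt0 ?ln2_gt0 //.
by rewrite ler_ln ?posrE // (lt_le_trans x0).
Qed.

Lemma log2_le x y : 0 < x -> 0 < y -> log2 x <= log2 y -> x <= y.
Proof.
move=> x0 y0; rewrite /log2 ler_pM2r ?invr_gt0 ?ln2_gt0 //.
by rewrite ler_ln ?posrE.
Qed.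

Lemma log2_ge0 x : 1 <= x -> 0 <= log2 x.
Proof. by move=> x1; apply: divr_ge0; [exact: ln_ge0 | exact/ltW/ln2_gt0]. Qed.

(** From [ln x <= 2 * sqrt x] and [ln 2 >= 1 / 2]; the bound on [x] says that [4 * C <= sqrt x]. *)
Lemma log2_sublinear (C x : R) : 0 < C -> 1 <= x -> 16 * C ^+ 2 <= x -> C * log2 x <= x.
Proof.
move=> C0 x1 Cx; have x0 : 0 < x by lra.
have s0 : 0 < Num.sqrt x by rewrite sqrtr_gt0.
have sx : x = Num.sqrt x ^+ 2 by rewrite sqr_sqrtr // ltW.
have Cs : 4 * C <= Num.sqrt x.
  rewrite -(@ler_pXn2r _ 2) // ?nnegrE; [|lra|exact: ltW].
  by rewrite -sx; move: Cx; rewrite !expr2; lra.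
have h : ln x <= 2 * Num.sqrt x.
  rewrite {1}sx lnXn // -[leLHS]mulr_natl ler_pM2l //; exact/ltW/ln_sublinear.
have l2 := ln2_ge_half; have l20 := ln2_gt0 R.
rewrite /log2 mulrA ler_pdivrMr //.
apply: (@le_trans _ _ (C * (2 * Num.sqrt x))); first by rewrite ler_pM2l.
apply: (@le_trans _ _ (x * (1 / 2))); last by rewrite ler_pM2l.
by rewrite {2}sx expr2; nra.
Qed.

(** One inequality for all [x] from half of [log2 n] on, to be used at [log2 n], at [n] and at the
    number of choices. *)
Definition large (n : nat) := 1 <= log2 n%:R :> R /\
  forall x, log2 n%:R / 2 <= x -> 20 * (20 * (log2 x + 10)) <= x.

Lemma log2_near (T : R) : \forall n \near \oo%classic, T <= log2 n%:R.
Proof.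
exists (2 ^ (Num.truncn `|T|).+1)%N => // n /= hn.
apply: (@le_trans _ _ (Num.truncn `|T|).+1%:R).
  by apply: le_trans (ler_norm T) _; apply/ltW/truncnS_gt.
rewrite -[leLHS]log2_pow2; apply: ler_log2; first exact: exprn_gt0.
by rewrite -natrX ler_nat.
Qed.

Lemma large_near : \forall n \near \oo%classic, large n.
Proof.
pose C : R := 2 * (20 * 20); pose C2 := 16 * C ^+ 2.
have C20 : 0 <= C2 by rewrite mulr_ge0 // sqr_ge0.
have := log2_near (2 * (C2 + 20 * (20 * 20))); apply: filterS => n; move: C20.
rewrite /large; move: (log2 n%:R) => L C20 hL.
split; first by move: hL C20; clear; lra.
move=> x hx; have x1 : C2 + 20 * (20 * 20) <= x by move: hx hL; clear; lra.
have : C * log2 x <= x.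
  by apply: log2_sublinear; rewrite -/C2 /C; move: x1 C20; clear; lra.
by rewrite /C; move: x1 C20; clear; move: C2 (log2 x) => a b; lra.
Qed.

Section LargeN.
Variable n : nat.
Hypothesis nL : large n.
Notation N := (n%:R : R).
Notation L := (log2 (n%:R : R)).
Notation l := (log2 (log2 (n%:R : R))).

Lemma large_n_gt0 : 0 < N.
Proof.
case: nL => h _; rewrite ltr0n lt0n; apply/negP => /eqP e.
by move: h; rewrite e /log2 ln0 // mul0r; lra.
Qed.

Lemma large_L : 20 * (20 * (l + 10)) <= L /\ 10 * (20 * 20) <= L.
Proof.
have [h1 h2] := nL; have h : L / 2 <= L by lra.
have := h2 _ h; have := log2_ge0 h1; split; lra.
Qed.

Lemma large_N : 20 * (20 * (L + 10)) <= N.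
Proof.
have [h1 h2] := nL; apply: h2.
have n0 := large_n_gt0.
have := ln_sublinear n0; have l2 := ln2_ge_half;
have : L * ln 2 = ln N by rewrite /log2 divfK // gt_eqF // ln2_gt0.
have : L * (1 / 2) <= L * ln 2 by rewrite ler_pM2l //; lra.
lra.
Qed.

Lemma large_L20 : 20 <= L.
Proof. by have [_ h] := large_L; lra. Qed.

Lemma large_NL : 2 * L <= N.
Proof. by have := large_N; have := large_L20; move: N L => x y; lra. Qed.

End LargeN.
End Log2.

(** * The second moment bound below the threshold *)

Section Numeric1.
Variable R : realType.
Variables (n k : nat).
Hypothesis nL : large R n.
Notation N := (n%:R : R).
Notation L := (log2 (n%:R : R)).
Notation l := (log2 (log2 (n%:R : R))).

Lemma log2_1B_ge (t : R) : 0 <= t <= 1 / 2 -> - (4 * t) <= log2 (1 - t).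
Proof.
move=> /andP[t0 t1]; have t2 : 0 < 1 - t by lra.
have h : ln (1 + t / (1 - t)) <= t / (1 - t).
  by apply: le_ln1Dx; apply: (@lt_le_trans _ _ 0); [lra | rewrite divr_ge0 ?(ltW t2)].
have e : 1 + t / (1 - t) = (1 - t)^-1 by field; rewrite gt_eqF.
have h2 : t / (1 - t) <= 2 * t by rewrite ler_pdivrMr //; nra.
move: h; rewrite e lnV ?posrE // => h.
have l2 := ln2_ge_half R; have l20 := ln2_gt0 R.
by rewrite /log2 ler_pdivlMr //; nra.
Qed.

Lemma log2_ge8 : 8 <= l.
Proof.
have [_ h] := large_L nL; rewrite -(log2_pow2 R 8); apply: ler_log2 => //.
apply: le_trans h; have -> : 10 * (20 * 20) = (10 * (20 * 20))%N%:R :> R by rewrite !natrM.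
by rewrite -natrX ler_nat.
Qed.

Lemma isolation_prob_gt0 : (k < n)%N -> 0 < isolation_prob R n k.
Proof.
move=> kn; have n0 : (0 < n)%N by apply: leq_trans kn.
rewrite /isolation_prob mulr_gt0 // exprn_gt0 // ?invr_gt0 ?ltr0n ?bin_gt0 ?(ltnW kn) //.
by rewrite subr_gt0 ltr_pdivrMr ?ltr0n // mul1r ltr_nat.
Qed.

(** In logarithms, with [P = 2 ^+ k], isolation costs at most [P * k * (L + 8)], where the 8
    accounts for the outer neighbours. Inserting [k <= L - 2 * l] and [P * L ^+ 2 <= N] bounds this
    by [N] minus a surplus. *)
Lemma second_moment_small : (0 < k)%N -> (k < n)%N -> k%:R + 2 * l <= L ->
  ((n.+1 * 2 ^ k) ^ 2)%:R / ((2 ^ n)%:R * isolation_prob R n k) <= N^-1.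
Proof.
move=> k0 kn kL.
have p0 := isolation_prob_gt0 kn; have N0 := large_n_gt0 nL.
have hL := large_L20 nL; have hN := large_NL nL; have l8 := log2_ge8.
have D0 : 0 < (2 ^ n)%:R * isolation_prob R n k by apply: mulr_gt0; rewrite // ltr0n expn_gt0.
rewrite ler_pdivrMr // ler_pdivlMl //.
have n1 : 1 <= N by lra.
have kN : k%:R <= N / 2 by lra.
pose P : R := 2 ^+ k.
have PL : P * L ^+ 2 <= N.
  apply: log2_le => //; first by rewrite mulr_gt0 // exprn_gt0 //; lra.
  by rewrite log2M ?exprn_gt0 // ?log2_pow2 ?log2X //; lra.
have P2 : 2 <= P by rewrite /P -[leLHS]expr1 ler_eXn2l // ltr1n.
have k1 : 1 <= k%:R :> R by rewrite ler1n.
have c0 : 0 < 'C(n, k)%:R :> R by rewrite ltr0n bin_gt0 ltnW.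
have b0 : 0 < 1 - k%:R / N by rewrite subr_gt0 ltr_pdivrMr // mul1r ltr_nat.
have hC : log2 ('C(n, k)%:R : R) <= k%:R * L.
  by rewrite -log2X //; apply: ler_log2 => //; rewrite -natrX ler_nat bin_le_expn.
have hb : - (4 * (k%:R / N)) <= log2 (1 - k%:R / N).
  apply: log2_1B_ge; rewrite divr_ge0 ?ler0n //= ler_pdivrMr //; lra.
apply: log2_le.
- by rewrite mulr_gt0 // ltr0n expn_gt0 muln_gt0 /= expn_gt0.
- by rewrite mulr_gt0 // ltr0n expn_gt0.
have -> : log2 (N * ((n.+1 * 2 ^ k) ^ 2)%:R) = L + 2 * (log2 (n.+1%:R : R) + k%:R).
  rewrite log2M // ?ltr0n ?expn_gt0 ?muln_gt0 ?expn_gt0 // natrX log2X; last first.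
    by rewrite ltr0n muln_gt0 expn_gt0.
  by rewrite natrM log2M ?ltr0n ?expn_gt0 // natrX log2_pow2.
have hn1 : log2 (n.+1%:R : R) <= 1 + L.
  rewrite -[X in X + _](log2_2 R) -log2M //; apply: ler_log2; first by rewrite ltr0n.
  by rewrite -natr1; move: n1; clear; move: N => x; lra.
rewrite log2M ?ltr0n ?expn_gt0 // natrX log2_pow2 /isolation_prob.
rewrite log2M ?exprn_gt0 ?invr_gt0 // !log2X ?invr_gt0 // log2V //.
have -> : (2 ^ k)%:R = P by rewrite natrX.
have -> : (n.+1 * 2 ^ k)%:R = n.+1%:R * P by rewrite natrM natrX.
have hb2 : - (8 * k%:R * P) <= n.+1%:R * P * log2 (1 - k%:R / N).
  apply: (@le_trans _ _ (n.+1%:R * P * - (4 * (k%:R / N)))); last first.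
    by rewrite ler_pM2l // mulr_gt0 ?ltr0n //; lra.
  have : n.+1%:R / N <= 2.
    by rewrite ler_pdivrMr // -natr1; move: n1; clear; move: N => x; lra.
  have -> : n.+1%:R * P * - (4 * (k%:R / N)) = - (4 * k%:R * P * (n.+1%:R / N)) by ring.
  have : 0 <= k%:R * P by rewrite mulr_ge0 //; lra.
  nra.
have hC2 : P * log2 ('C(n, k)%:R : R) <= P * (k%:R * L) by rewrite ler_pM2l //; lra.
have : P * k%:R * (L + 8) <= P * (L - 2 * l) * (L + 8).
  by rewrite ler_pM2r; [rewrite ler_pM2l; lra | lra].
(* As [l >= 8], the gain from the double logarithm is at least twice the loss [8 * L]; what remains
   pays for the number of meeting blocks. *)
have : 16 * L <= 2 * l * L + 16 * l by nra.
move: hb2 hC2 PL; rewrite expr2.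
set lC := log2 'C(n, k)%:R; set lb := n.+1%:R * P * _.
move=> h1 h2 h3 h4 h5.
have h6 : P * (16 * L) <= P * (2 * l * L + 16 * l) by rewrite ler_pM2l //; lra.
have h7 : 2 * L <= P * L by rewrite ler_pM2r; lra.
nra.
Qed.

End Numeric1.

(** * How large a separated set must be *)

Section ComponentSize.
Variable R : realType.

Lemma expr_le_inv (a B : R) (e : nat) : 0 < a -> 0 < B ->
  e%:R * log2 a + log2 B <= 0 -> a ^+ e <= B^-1.
Proof.
move=> a0 B0 h; apply: log2_le; rewrite ?invr_gt0 ?exprn_gt0 //.
by rewrite log2X // log2V //; lra.
Qed.

Lemma log2_four_fifths : log2 (4 / 5 : R) <= - (1 / 4).
Proof.
have h : log2 ((4 / 5) ^+ 4) <= log2 (2^-1) :> R.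
  by apply: ler_log2; rewrite ?exprn_gt0 //; lra.
by move: h; rewrite log2X // log2V // log2_2; lra.
Qed.

(** A bootstrap. The crude bound [w <= 3 * s] already makes [log2 s] linear in [k], so [s] exceeds
    [4 * k ^ 2] and [w] is close to [s]. Then [w * log2 w >= k * s] is impossible unless [w] is
    nearly [2 ^+ k]. *)
Lemma component_size (k s w : nat) : (0 < k)%N ->
  20 * (20 * (log2 (k%:R : R) + 10)) <= k%:R ->
  (0 < s)%N -> (s <= w < s + k)%N -> (k <= 2 * s)%N ->
  (k * s)%:R <= w%:R * log2 (w%:R : R) ->
  3 / 4 * 2 ^+ k <= s%:R :> R /\ 20 * k%:R <= 2 ^+ k :> R.
Proof.
move=> k0 hk s0 /andP[sw wk] ks2; rewrite natrM.
have S1 : 1 <= s%:R :> R by rewrite ler1n.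
have K1 : 1 <= k%:R :> R by rewrite ler1n.
have W1 : 1 <= w%:R :> R by rewrite ler1n (leq_trans s0).
have SW : s%:R <= w%:R :> R by rewrite ler_nat.
have WK : w%:R <= s%:R + k%:R :> R by rewrite -natrD ler_nat ltnW.
have KS : k%:R <= 2 * s%:R :> R by rewrite -natrM ler_nat.
have lk := log2_ge0 K1.
have hP : 20 * k%:R <= 2 ^+ k :> R.
  apply: log2_le; rewrite ?exprn_gt0 ?mulr_gt0 //; try lra.
  rewrite log2_pow2 log2M //; last by lra.
  have : log2 (20 : R) <= log2 (2 ^+ 5) by apply: ler_log2 => //; rewrite -natrX ler_nat.
  by rewrite log2_pow2; lra.
have P0 : 0 < 2 ^+ k :> R by apply: exprn_gt0.
have PE : log2 (2 ^+ k : R) = k%:R by rewrite log2_pow2.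
move: (2 ^+ k) P0 PE hP => P P0 PE hP.
move: (k%:R : R) (s%:R : R) (w%:R : R) hk S1 K1 W1 SW WK KS lk hP PE.
move=> K S W hk S1 K1 W1 SW WK KS lk hP PE h.
have ls := log2_ge0 S1; have lw := log2_ge0 W1.
have h1 : log2 W <= 2 + log2 S.
  have <- : log2 (2 ^+ 2 * S) = 2 + log2 S by rewrite log2M ?log2_pow2 ?exprn_gt0 //; lra.
  by apply: ler_log2; rewrite ?expr2; lra.
have h2 : K <= 6 + 3 * log2 S.
  have : S * K <= S * (6 + 3 * log2 S); last by rewrite ler_pM2l //; lra.
  have : W * log2 W <= (3 * S) * (2 + log2 S) by apply: ler_pM; lra.
  by move: h; clear; lra.
have h3 : 4 * K ^+ 2 < S.
  rewrite ltNge; apply/negP => c; have : log2 S <= log2 (2 ^+ 2 * K ^+ 2).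
    by apply: ler_log2; move: c; rewrite ?expr2; lra.
  rewrite log2M ?exprn_gt0 ?log2_pow2 ?log2X //; lra.
(* Otherwise [log2 W <= K - 1 / 4], and [(S + K) * (K - 1 / 4) < S * K] because [S > 4 * K ^+ 2].
   The final constant is [3 / 4 = 4 / 5 - 1 / 20]. *)
have h4 : 4 / 5 * P < S + K.
  rewrite ltNge; apply/negP => c.
  have : log2 W <= log2 (4 / 5 * P) by apply: ler_log2; lra.
  rewrite log2M // PE => h5; have h6 := log2_four_fifths.
  have h7 : W * log2 W <= (S + K) * (K - 1 / 4) by apply: ler_pM; lra.
  by move: h h7 h3 K1; rewrite expr2; clear; lra.
split => //; lra.
Qed.

End ComponentSize.

(** * Estimates for small components above the threshold, with [k = j + 1] *)

Section Numeric2.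
Variable R : realType.
Variables (n j : nat).
Hypothesis nL : large R n.
Notation N := (n%:R : R).
Notation L := (log2 (n%:R : R)).
Notation l := (log2 (log2 (n%:R : R))).
Hypothesis jn : (j.+1 < n)%N.
Hypothesis Lj : L <= j%:R + 2 * l.

Lemma choices_ge : 199 / 200 * L <= j%:R.
Proof. by have [h _] := large_L nL; have h' := Lj; lra. Qed.

Lemma pow_choices_ge : N <= 2 ^+ j * L ^+ 2.
Proof.
have L0 := large_L20 nL; have N0 := large_n_gt0 nL.
apply: log2_le => //; first by rewrite mulr_gt0 // exprn_gt0 //; lra.
by rewrite log2M ?exprn_gt0 // ?log2_pow2 ?log2X //; have h := Lj; lra.
Qed.

Lemma large_L2N : L ^+ 2 <= N.
Proof.
have L0 := large_L20 nL; have N0 := large_n_gt0 nL; have [h _] := large_L nL.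
apply: log2_le => //; first by rewrite exprn_gt0 //; lra.
rewrite log2X; last by lra.
by lra.
Qed.

Lemma large_LN : 20 * (20 * 10) * L <= N.
Proof.
apply: le_trans large_L2N; have [_ h] := large_L nL; have L0 := large_L20 nL.
by rewrite expr2 ler_pM2r; lra.
Qed.

Lemma log2_succ_le (x : nat) : (0 < x)%N -> log2 (x.+1%:R : R) <= 1 + log2 (x%:R : R).
Proof.
move=> x0; have x1 : 1 <= x%:R :> R by rewrite ler1n.
have <- : log2 (2 * x%:R : R) = 1 + log2 (x%:R : R) by rewrite log2M ?log2_2 //; lra.
by apply: ler_log2; rewrite -natr1; lra.
Qed.

(** The logarithm of one term of the union bound: [la] belongs to the base of the probability, the
    bracket to the counting. The main term is about [- K * S * L], and [K * S * L] is nearly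
    [3 / 2 * N] or more, since [S * L ^+ 2 >= 3 / 2 * N]; the other terms are small fractions of it
    or of [N]. *)
Lemma arith_small (K S la lx d P : R) : 199 / 200 * L <= K ->
  3 / 4 * P <= S -> 20 * K <= P -> 2 * N <= P * L ^+ 2 ->
  la <= - (399 / 400 * L) -> lx <= 4 * L -> d <= N / 32 ->
  K * S * la + (N + 2 * S * L + K * lx + L + d) <= 0.
Proof.
have [_ hL] := large_L nL; have hN := large_LN.
move: (N) (L) hL hN => X Y hL hN h1 h2 h3 h4 h5 h6 h7.
have Y0 : 0 < Y by lra.
have S0 : 0 < S by lra.
have K0 : 0 < K by lra.
have e1 : K * S * la <= - (399 / 400) * (K * S * Y).
  have -> : - (399 / 400) * (K * S * Y) = K * S * - (399 / 400 * Y) by ring.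
  by rewrite ler_pM2l // mulr_gt0.
have e2 : 20 * (5 * (2 * S * Y)) <= K * S * Y.
  rewrite -subr_ge0 (_ : _ - _ = (K - 20 * 10) * (S * Y)); last by ring.
  by apply: mulr_ge0; [lra | rewrite ltW // mulr_gt0].
have e3 : 20 * (5 * (K * lx)) <= K * S * Y.
  have : K * lx <= K * (4 * Y) by rewrite ler_pM2l.
  have : K * (20 * (20 * Y)) <= K * (S * Y) by rewrite ler_pM2l // mulrA ler_pM2r //; lra.
  by rewrite -mulrA; clear; lra.
have e4 : 199 / 200 * (S * Y ^+ 2) <= K * S * Y.
  have -> : 199 / 200 * (S * Y ^+ 2) = 199 / 200 * Y * (S * Y) by ring.
  by rewrite -[leRHS]mulrA ler_pM2r // mulr_gt0.
have e5 : 3 / 4 * (2 * X) <= S * Y ^+ 2.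
  have : 3 / 4 * P * Y ^+ 2 <= S * Y ^+ 2 by rewrite ler_pM2r // exprn_gt0.
  by move: h4; clear; lra.
by move: e1 e2 e3 e4 e5 hN hL h7; clear; move: (K * S * la) (K * S * Y) (S * Y ^+ 2) => *; lra.
Qed.

Lemma arith_medium (K S la lx d : R) : 199 / 200 * L <= K -> K <= N ->
  N ^+ 2 <= S -> la <= - 3 -> lx <= N / 4 -> d <= N / 32 ->
  K * S * la + (N + 2 * S * L + K * lx + L + d) <= 0.
Proof.
have [_ hL] := large_L nL; have hN := large_LN.
move: (N) (L) hL hN => X Y hL hN h1 h2 h3 h4 h5 h6.
have Y0 : 20 < Y by lra.
have XS : 20 * X <= S by apply: le_trans h3; rewrite expr2 ler_pM2r; lra.
have S0 : 0 < S by lra.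
have K0 : 1 < K by lra.
have e1 : K * S * la <= K * S * (- 3) by rewrite ler_pM2l // mulr_gt0 //; lra.
have e2 : 199 / 200 * (S * Y) <= K * S by rewrite mulrCA [K * S]mulrC ler_pM2l.
have e3 : K * lx <= K * (S * (1 / 20)) by rewrite ler_pM2l; lra.
have e4 : S <= K * S by rewrite ler_peMl; lra.
move: e1 e2 e3 e4 XS hN hL h6; clear; rewrite [K * (S * _)]mulrA.
by rewrite -[2 * S * Y]mulrA; move: (K * S * la) (K * S) (S * Y) (K * lx) => *; lra.
Qed.

Lemma degree_sum_small (W S lw Y : R) : 0 <= W -> 0 <= lw -> W <= 3 * S ->
  lw <= 2 + 2 * Y -> 6 <= Y -> W * lw <= 8 * Y * S.
Proof.
move=> W0 lw0 WS lwY Y6.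
apply: (@le_trans _ _ (3 * S * (2 + 2 * Y))); first exact: ler_pM.
have : 0 <= S * (Y - 6) by rewrite mulr_ge0; lra.
lra.
Qed.

Lemma degree_sum_medium (W S lw X : R) : 0 <= W -> 0 <= lw -> W <= 2 * S ->
  lw <= 1 + X / 32 -> 32 <= X -> W * lw <= 8^-1 * (S * X).
Proof.
move=> W0 lw0 WS lwX X32.
apply: (@le_trans _ _ (2 * S * (1 + X / 32))); first exact: ler_pM.
have : 0 <= S * (X - 32) by rewrite mulr_ge0; lra.
lra.
Qed.

(** The right side is the inverse of the counting factor times [n] and the number of sizes, so that
    the sum over [s] becomes [1 / n]. *)
Lemma small_component_num (s w : nat) : (0 < s <= 2 ^ (n %/ 32))%N ->
  (s <= w < s + j.+1)%N -> (j.+1 <= 2 * s)%N ->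
  (j.+1 * s)%:R <= w%:R * log2 (w%:R : R) ->
  (w%:R * log2 w%:R / (s%:R * N)) ^+ (j.+1 * s) <=
  (((2 ^ n * n ^ (2 * s) * (s * n).+1 ^ j.+1)%:R * (N * (2 ^ (n %/ 32))%:R)))^-1.
Proof.
move=> /andP[s0 sm] sw ks h.
have N0 := large_n_gt0 nL; have n0 : (0 < n)%N by rewrite -(ltr_nat R).
have L20 := large_L20 nL; have NL := large_LN; have cj := choices_ge.
have S1 : 1 <= s%:R :> R by rewrite ler1n.
have WS : w%:R <= s%:R + j.+1%:R :> R by rewrite -natrD ler_nat; case/andP: sw => _ /ltnW.
have W1 : 1 <= w%:R :> R by rewrite ler1n; case/andP: sw => sw _; apply: leq_trans sw.
have KS : j.+1%:R <= 2 * s%:R :> R by rewrite -natrM ler_nat.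
have KN : j.+1%:R <= N by rewrite ler_nat ltnW.
have cK : 199 / 200 * L <= j.+1%:R by rewrite -natr1; lra.
have SN0 : 0 < s%:R * N by rewrite mulr_gt0 //; lra.
have a0 : 0 < w%:R * log2 (w%:R : R).
  by apply: lt_le_trans h; rewrite ltr0n muln_gt0 s0.
have ls0 := log2_ge0 S1.
have d32 : (n %/ 32)%:R <= N / 32.
  by rewrite ler_pdivlMr // -natrM ler_nat leq_divM.
have lsd : log2 (s%:R : R) <= (n %/ 32)%:R.
  rewrite -[leRHS]log2_pow2; apply: ler_log2; first by lra.
  by rewrite -natrX ler_nat.
apply: expr_le_inv; first by rewrite divr_gt0.
  by rewrite mulr_gt0 ?mulr_gt0 ?ltr0n // ?muln_gt0 ?expn_gt0 ?n0.
have -> : log2 ((2 ^ n * n ^ (2 * s) * (s * n).+1 ^ j.+1)%:R * (N * (2 ^ (n %/ 32))%:R)) =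
   N + 2 * s%:R * L + j.+1%:R * log2 ((s * n).+1%:R : R) + L + (n %/ 32)%:R :> R.
  rewrite !natrM !natrX log2M ?mulr_gt0 ?exprn_gt0 ?ltr0n //.
  rewrite log2M ?mulr_gt0 ?exprn_gt0 ?ltr0n // log2M ?exprn_gt0 //
    [log2 (N * _)]log2M ?exprn_gt0 //.
  by rewrite !log2_pow2 !log2X ?ltr0n // natrM addrA.
have lx : log2 ((s * n).+1%:R : R) <= 1 + log2 (s%:R : R) + L.
  apply: le_trans (log2_succ_le _) _; first by rewrite muln_gt0 s0.
  by rewrite natrM log2M //; lra.
(* Up to [n ^ 2] the base is at most [8 * L / N], and [component_size] bounds [s] from below. Beyond
   [n ^ 2] the bound [log2 s <= n / 32] makes the base at most [1 / 8], which suffices for so large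
   an [s]. *)
rewrite natrM; have [sn|sn] := leqP s (n ^ 2).
  have ck : 20 * (20 * (log2 (j.+1%:R : R) + 10)) <= j.+1%:R.
    by case: nL => _; apply; lra.
  have [hS hK] := component_size (ltn0Sn j) ck s0 sw ks h.
  apply: (arith_small cK hS hK) => //.
  - by rewrite exprS -mulrA ler_pM2l // pow_choices_ge.
  - have ls2 : log2 (s%:R : R) <= 2 * L.
      by rewrite -log2X //; apply: ler_log2; [lra | rewrite -natrX ler_nat].
    have lw : log2 (w%:R : R) <= 2 + log2 (s%:R : R).
      have <- : log2 (2 ^+ 2 * s%:R : R) = 2 + log2 (s%:R : R).
        by rewrite log2M ?log2_pow2 ?exprn_gt0 //; lra.
      by apply: ler_log2; rewrite ?expr2; lra.
    have lw0 := log2_ge0 W1.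
    apply: (@le_trans _ _ (log2 (2 ^+ 3 * L / N))).
      apply: ler_log2; first by rewrite divr_gt0.
      rewrite ler_pdivrMr // [leRHS](_ : _ = 2 ^+ 3 * L * s%:R); last by field; rewrite gt_eqF.
      have -> : (2 : R) ^+ 3 = 8 by rewrite !exprS expr0; ring.
      by apply: degree_sum_small => //; lra.
    have L0 : 0 < L by lra.
    have P8 : 0 < 2 ^+ 3 :> R by apply: exprn_gt0.
    rewrite (log2M (mulr_gt0 P8 L0)) ?invr_gt0 // (log2M P8 L0) log2_pow2 log2V //.
    by have [hl _] := large_L nL; lra.
  - apply: le_trans lx _.
    have ls2 : log2 (s%:R : R) <= 2 * L.
      by rewrite -log2X //; apply: ler_log2; [lra | rewrite -natrX ler_nat].
    lra.
have sn' : N ^+ 2 <= s%:R by rewrite -natrX ler_nat ltnW.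
have NS : N <= s%:R by apply: le_trans sn'; rewrite expr2 ler_peMl; lra.
apply: arith_medium => //; last by lra.
have lw : log2 (w%:R : R) <= 1 + log2 (s%:R : R).
  have <- : log2 (2 * s%:R : R) = 1 + log2 (s%:R : R) by rewrite log2M ?log2_2 //; lra.
  by apply: ler_log2; lra.
have lw0 := log2_ge0 W1.
apply: (@le_trans _ _ (log2 (2 ^+ 3)^-1)); last by rewrite log2V ?exprn_gt0 // log2_pow2.
apply: ler_log2; first by rewrite divr_gt0.
have -> : (2 : R) ^+ 3 = 8 by rewrite !exprS expr0; ring.
rewrite ler_pdivrMr //.
by apply: degree_sum_medium => //; lra.
Qed.

End Numeric2.

(** * Estimates for the first round and for large components *)

Section Numeric3.
Variable R : realType.
Variables (n j : nat).
Hypothesis nL : large R n.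
Notation N := (n%:R : R).
Notation L := (log2 (n%:R : R)).
Notation l := (log2 (log2 (n%:R : R))).
Hypothesis jn : (j.+1 < n)%N.
Hypothesis Lj : L <= j%:R + 2 * l.

(** With only [j] choices the factor 2 of [arith_small] is lost: [J * S * L] is only known to be
    nearly [N]. The small deficit is covered by [d], about [N / 48], which stands for the tolerated
    number [2 ^ (n %/ 48)] of vertices in small components. *)
Lemma arith_many (J S la ls d P : R) : 199 / 200 * L <= J ->
  P <= S -> N <= P * L ^+ 2 -> la <= - (399 / 400 * L) -> ls <= 4 * L -> N / 48 - 1 <= d ->
  J * S * la + (5 * L + N + 2 * S * L + ls - d) <= 0.
Proof.
have [_ hL] := large_L nL; have hN := large_LN nL.
move: (N) (L) hL hN => X Y hL hN h1 h2 h3 h4 h5 h6.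
have Y0 : 0 < Y by lra.
have P0 : 0 < P.
  by rewrite -(@pmulr_lgt0 _ (Y ^+ 2)) ?exprn_gt0 //; lra.
have S0 : 0 < S by lra.
have J0 : 0 < J by lra.
have e1 : J * S * la <= - (399 / 400) * (J * S * Y).
  have -> : - (399 / 400) * (J * S * Y) = J * S * - (399 / 400 * Y) by ring.
  by rewrite ler_pM2l // mulr_gt0.
have e2 : 20 * (10 * (2 * S * Y)) <= J * S * Y.
  rewrite -subr_ge0 (_ : _ - _ = (J - 20 * 20) * (S * Y)); last by ring.
  by apply: mulr_ge0; [lra | rewrite ltW // mulr_gt0].
have e4 : 199 / 200 * (S * Y ^+ 2) <= J * S * Y.
  have -> : 199 / 200 * (S * Y ^+ 2) = 199 / 200 * Y * (S * Y) by ring.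
  by rewrite -[leRHS]mulrA ler_pM2r // mulr_gt0.
have e5 : X <= S * Y ^+ 2.
  by apply: le_trans h3 _; rewrite ler_pM2r // exprn_gt0.
rewrite -mulrA in e2 *.
move: e1 e2 e4 e5 hN hL h5 h6.
by move: (J * (S * la)) (J * S * la) (J * S * Y) (S * Y ^+ 2) (S * Y) => *; lra.
Qed.

Lemma many_small_num (s : nat) : (0 < s <= n ^ 4)%N ->
  (j * s)%:R <= s%:R * log2 (s%:R : R) ->
  (s%:R * log2 s%:R / (s%:R * N)) ^+ (j * s) <=
  ((N * (n ^ 4)%:R * (2 ^ n * n ^ (2 * s) * s)%:R) / (2 ^ (n %/ 48))%:R)^-1.
Proof.
move=> /andP[s0 sm] h.
have N0 := large_n_gt0 nL; have n0 : (0 < n)%N by rewrite -(ltr_nat R).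
have L20 := large_L20 nL; have cj := choices_ge nL Lj.
have S1 : 1 <= s%:R :> R by rewrite ler1n.
have S0 : 0 < s%:R :> R by rewrite ltr0n.
have jls : j%:R <= log2 (s%:R : R) by move: h; rewrite natrM mulrC ler_pM2l.
have ls4 : log2 (s%:R : R) <= 4 * L.
  by rewrite -log2X //; apply: ler_log2; [| rewrite -natrX ler_nat].
have P8 : 0 < 2 ^+ 2 :> R by apply: exprn_gt0.
have L0 : 0 < L by lra.
have ls0 : 0 < log2 (s%:R : R) by lra.
have a0 : 0 < s%:R * log2 s%:R / (s%:R * N) by apply: divr_gt0; apply: mulr_gt0.
have B0 : 0 < N * (n ^ 4)%:R * (2 ^ n * n ^ (2 * s) * s)%:R.
  by rewrite -!natrM ltr0n !muln_gt0 !expn_gt0 n0 s0.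
have D0 : 0 < (2 ^ (n %/ 48))%:R^-1 :> R by rewrite invr_gt0 ltr0n expn_gt0.
apply: expr_le_inv => //; first by rewrite mulr_gt0.
have -> : log2 (N * (n ^ 4)%:R * (2 ^ n * n ^ (2 * s) * s)%:R / (2 ^ (n %/ 48))%:R) =
    5 * L + N + 2 * s%:R * L + log2 (s%:R : R) - (n %/ 48)%:R.
  rewrite (log2M B0 D0) log2V ?ltr0n ?expn_gt0 // !natrM !natrX.
  have x1 : 0 < N ^+ 4 by apply: exprn_gt0.
  have x2 : 0 < 2 ^+ n :> R by apply: exprn_gt0.
  have x3 : 0 < N ^+ (2 * s) by apply: exprn_gt0.
  rewrite (log2M (mulr_gt0 N0 x1) (mulr_gt0 (mulr_gt0 x2 x3) S0)) (log2M N0 x1).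
  rewrite (log2M (mulr_gt0 x2 x3) S0) (log2M x2 x3) !log2_pow2 !log2X // natrM; ring.
rewrite natrM; apply: (@arith_many _ _ _ _ _ (2 ^+ j)) => //.
- apply: log2_le => //.
  by rewrite log2_pow2.
- exact: pow_choices_ge.
- apply: (@le_trans _ _ (log2 (2 ^+ 2 * L / N))).
    apply: ler_log2 => //.
    have -> : s%:R * log2 s%:R / (s%:R * N) = log2 (s%:R : R) / N.
      by rewrite -mulf_div divff ?mul1r // gt_eqF.
    by rewrite ler_pM2r ?invr_gt0 // expr2; lra.
  rewrite (log2M (mulr_gt0 P8 L0)) ?invr_gt0 // (log2M P8 L0) log2_pow2 log2V //.
  by have [hl _] := large_L nL; lra.
have := ltn_ceil n (isT : 0 < 48)%N; rewrite -(ltr_nat R) natrM -natr1 => hd.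
lra.
Qed.

Lemma large_threshold :
  4 * N ^+ 2 * (2 ^ (n %/ 48))%:R <= (2 ^ (n %/ 32))%:R :> R /\
  8 * N ^+ 8 <= (2 ^ (n %/ 32))%:R :> R.
Proof.
have N0 := large_n_gt0 nL; have L20 := large_L20 nL; have hN := large_LN nL.
have := ltn_ceil n (isT : 0 < 32)%N; rewrite -(ltr_nat R) natrM -natr1 => hd.
have hd' : (n %/ 48)%:R * 48%:R <= N by rewrite -natrM ler_nat leq_divM.
have x2 : 0 < N ^+ 2 by apply: exprn_gt0.
have x8 : 0 < N ^+ 8 by apply: exprn_gt0.
have y2 : 0 < 2 ^+ 2 :> R by apply: exprn_gt0.
have y3 : 0 < 2 ^+ 3 :> R by apply: exprn_gt0.
have e2 : (2 : R) ^+ 2 = 4 by rewrite !exprS expr0; ring.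
have e3 : (2 : R) ^+ 3 = 8 by rewrite !exprS expr0; ring.
have z : 0 < 2 ^+ (n %/ 48) :> R by apply: exprn_gt0.
have z' : 0 < 2 ^+ (n %/ 32) :> R by apply: exprn_gt0.
rewrite !natrX -e2 -e3; split; apply: log2_le; rewrite ?mulr_gt0 //.
  rewrite (log2M (mulr_gt0 y2 x2) z) (log2M y2 x2) !log2_pow2 log2X //; lra.
rewrite (log2M y3 x8) !log2_pow2 log2X //; lra.
Qed.

(** After multiplication by [X ^+ 2], the crossing vertices gain at least [S - X ^+ 2]. The
    fragments cost at most [X ^+ 2 * Z + X ^+ 8], a fraction of [S], and the roots are rare enough
    because [t <= S / X ^+ 4]. *)
Lemma arith_large (X Y Z D S r K b Q t : R) : 20 <= X -> 0 <= Y <= X -> 0 <= K <= X ->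
  0 <= r -> b <= - X^-1 -> 0 <= Q <= 2 * X -> S <= X * r + X * K ->
  4 * X ^+ 2 * Z <= D -> 8 * X ^+ 8 <= D -> D <= S -> 0 <= t -> t * X ^+ 4 <= S ->
  r * b + (Y + X + K * Q + (Z + K * (X * (X * (X * (X * X)))) + (t + 1) * Q)) <= 0.
Proof.
move=> X20 /andP[Y0 YX] /andP[K0 KX] r0 hb /andP[Q0 QX] hS hZ h8 DS t0 tS.
have X0 : 0 < X by lra.
have X2 : 0 < X ^+ 2 by apply: exprn_gt0.
have p3 : 20 * X ^+ 2 <= X ^+ 3 by rewrite [leRHS]exprS ler_pM2r.
have p4 : 20 * X ^+ 3 <= X ^+ 4 by rewrite [leRHS]exprS ler_pM2r ?exprn_gt0.
have p5 : X ^+ 4 <= X ^+ 8 by apply: ler_weXn2l => //; lra.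
have p4' : 20 * X ^+ 4 <= X ^+ 8.
  apply: (@le_trans _ _ (X ^+ 5)); last by apply: ler_weXn2l => //; lra.
  by rewrite [leRHS]exprS ler_pM2r ?exprn_gt0.
have e1 : X ^+ 2 * (r * b) <= - S + X ^+ 2.
  have : r * b <= r * - X^-1 by apply: ler_wpM2l.
  rewrite -(ler_pM2l X2) => /le_trans; apply.
  have -> : X ^+ 2 * (r * - X^-1) = - (X * r) by field; rewrite gt_eqF.
  have : X * K <= X ^+ 2 by rewrite expr2 ler_pM2l.
  by lra.
have e2 : X ^+ 2 * (Y + X) <= 2 * X ^+ 3.
  have -> : 2 * X ^+ 3 = X ^+ 2 * (2 * X) by ring.
  by rewrite ler_pM2l //; lra.
have e3 : X ^+ 2 * (K * Q) <= 2 * X ^+ 4.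
  have -> : 2 * X ^+ 4 = X ^+ 2 * (X * (2 * X)) by ring.
  by rewrite ler_pM2l //; apply: ler_pM.
have e4 : X ^+ 2 * (K * (X * (X * (X * (X * X))))) <= X ^+ 8.
  have -> : X ^+ 8 = X ^+ 2 * (X * (X * (X * (X * (X * X))))) by ring.
  by rewrite ler_pM2l // ler_wpM2r // !mulr_ge0 // ltW.
have e5 : X ^+ 2 * ((t + 1) * Q) <= 2 * (t * X ^+ 3) + 2 * X ^+ 3.
  have -> : 2 * (t * X ^+ 3) + 2 * X ^+ 3 = X ^+ 2 * ((t + 1) * (2 * X)) by ring.
  by rewrite ler_pM2l // ler_wpM2l //; lra.
have e6 : 20 * (t * X ^+ 3) <= S.
  by apply: le_trans tS; rewrite mulrCA; apply: ler_wpM2l.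
rewrite -(ler_pM2l X2) mulr0 !mulrDr.
rewrite !mulrDr in e2.
by lra.
Qed.

Lemma large_component_num (s r : nat) : (2 ^ (n %/ 32) < s)%N ->
  (s <= n * r + n * j.+1)%N ->
  (1 - N^-1) ^+ r <=
  ((N * (2 ^ n)%:R * ((2 ^ n).+1 ^ j.+1)%:R *
   (2 ^ (2 ^ (n %/ 48) + j.+1 * (n * n ^ 4)) * (2 ^ n).+1 ^ (s %/ (n ^ 4).+1).+1)%:R))^-1.
Proof.
move=> ms sr.
have N0 := large_n_gt0 nL; have n0 : (0 < n)%N by rewrite -(ltr_nat R).
have L20 := large_L20 nL; have hN := large_LN nL.
have N2 : 20 <= N by lra.
have [t1 t2] := large_threshold.
have b0 : 0 < 1 - N^-1 by rewrite subr_gt0 invf_lt1 //; lra.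
have b1 : log2 (1 - N^-1) <= - N^-1.
  have : ln (1 + - N^-1) <= - N^-1.
    by apply: le_ln1Dx; rewrite ltrN2 invf_lt1 //; lra.
  have := ln2_lt1 R; have := ln2_gt0 R; have Ni : 0 < N^-1 by rewrite invr_gt0.
  rewrite /log2 => l0 l1 h; rewrite ler_pdivrMr //; nra.
have x0 : 0 < (2 ^ n)%:R :> R by rewrite ltr0n expn_gt0.
have x1 : 0 < (2 ^ n).+1%:R :> R by rewrite ltr0n.
have q2 : log2 ((2 ^ n).+1%:R : R) <= 2 * N.
  apply: le_trans (log2_succ_le R _) _; first by rewrite expn_gt0.
  by rewrite natrX log2_pow2; lra.
have q0 : 0 <= log2 ((2 ^ n).+1%:R : R) by apply: log2_ge0; rewrite ler1n.
have KN : j.+1%:R <= N by rewrite ler_nat ltnW.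
have SN : s%:R <= N * r%:R + N * j.+1%:R :> R by rewrite -!natrM -natrD ler_nat.
have mS : (2 ^ (n %/ 32))%:R <= s%:R :> R by rewrite ler_nat ltnW.
set t := (s %/ (n ^ 4).+1)%N.
have tS : t%:R * N ^+ 4 <= s%:R.
  by rewrite -natrX -natrM ler_nat;
    apply: leq_trans (leq_divM s (n ^ 4).+1); rewrite leq_mul2l leqnSn orbT.
have y1 : 0 < (2 ^ n).+1%:R ^+ j.+1 :> R by apply: exprn_gt0.
have y2 : 0 < 2 ^+ (2 ^ (n %/ 48) + j.+1 * (n * n ^ 4)) :> R by apply: exprn_gt0.
have y3 : 0 < (2 ^ n).+1%:R ^+ t.+1 :> R by apply: exprn_gt0.
have E : N * (2 ^ n)%:R * ((2 ^ n).+1 ^ j.+1)%:R *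
   (2 ^ (2 ^ (n %/ 48) + j.+1 * (n * n ^ 4)) * (2 ^ n).+1 ^ t.+1)%:R =
  N * (2 ^ n)%:R * (2 ^ n).+1%:R ^+ j.+1 *
  (2 ^+ (2 ^ (n %/ 48) + j.+1 * (n * n ^ 4)) * (2 ^ n).+1%:R ^+ t.+1) :> R.
  by rewrite natrM !(natrX _ _ j.+1) !(natrX _ _ t.+1) [in LHS](natrX _ 2 (2 ^ _ + _)).
rewrite E; apply: expr_le_inv => //; first by rewrite !mulr_gt0.
rewrite (log2M (mulr_gt0 (mulr_gt0 N0 x0) y1) (mulr_gt0 y2 y3)) (log2M (mulr_gt0 N0 x0) y1).
rewrite (log2M N0 x0) (log2M y2 y3) !(log2X _ x1) log2_pow2 natrX log2_pow2.
rewrite natrD !natrM natrX -natrX.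
rewrite -[in t.+1%:R]natr1; apply: arith_large t1 t2 mS _ tS => //.
- by apply/andP; split; lra.
- by rewrite ler0n.
- by rewrite q0.
Qed.

End Numeric3.

(** * Explicit probability bounds and the limit *)

Lemma kout_prob_le1 (R : realType) (n k : nat) A : (k <= n)%N -> kout_prob R n k A <= 1.
Proof.
move=> kn; rewrite kout_probE.
have h (v : cube n) : \sum_(J : {set 'I_n}) unif R k J = 1 by rewrite sum_unifT.
by rewrite -(Pr_predT h); apply: le_Pr => // v J; apply: unif_ge0.
Qed.

Lemma disconnected_prob_ge (R : realType) (n k : nat) : large R n ->
  (0 < k)%N -> (k < n)%N -> k%:R <= k0 R n ->
  1 - n%:R^-1 <= kout_prob R n k (fun E => ~~ gconnected E).
Proof.
move=> nL k0 kn hk; have p0 := isolation_prob_gt0 R kn.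
apply: le_trans (kout_disconnected_ge kn p0); rewrite lerD2l lerN2.
by apply: second_moment_small => //; move: hk; rewrite /Defs.k0; lra.
Qed.

(** The bounding functions are inverses of the counting factors, normalised so that each of the
    three error terms is at most [1 / n]. *)
Lemma connected_prob_ge (R : realType) (n j : nat) : large R n ->
  (j.+1 < n)%N -> k0 R n <= j%:R ->
  1 - 3 * n%:R^-1 <= kout_prob R n j.+1 (fun E => kconnected E j.+1).
Proof.
move=> nL jn hk.
have Lj : log2 (n%:R : R) <= j%:R + 2 * log2 (log2 (n%:R : R)) by move: hk; rewrite /k0; lra.
have N0 := large_n_gt0 nL; have n0 : (0 < n)%N by rewrite -(ltr_nat R).
have j0 : (0 < j)%N.
  by rewrite -(ltr_nat R); have := choices_ge nL Lj; have := large_L20 nL; lra.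
have V0 (x : R) : 0 <= x -> 0 <= x^-1 by rewrite invr_ge0.
pose m := (2 ^ (n %/ 32))%N; pose z := (2 ^ (n %/ 48))%N; pose M := (n ^ 4)%N.
pose A1 s : R := (2 ^ n * n ^ (2 * s) * (s * n).+1 ^ j.+1)%:R.
pose A2 s : R := (2 ^ n * n ^ (2 * s) * s)%:R.
pose A3 s : R := (2 ^ (z + j.+1 * (n * M)) * (2 ^ n).+1 ^ (s %/ M.+1).+1)%:R.
pose B : R := ((2 ^ n).+1 ^ j.+1)%:R.
have b10 s : 0 <= (A1 s * (n%:R * m%:R))^-1 by rewrite V0 // !mulr_ge0.
have b20 s : 0 <= (n%:R * M%:R * A2 s / z%:R)^-1 by rewrite V0 // divr_ge0 // !mulr_ge0.
have g0 s : 0 <= (n%:R * (2 ^ n)%:R * B * A3 s)^-1 by rewrite V0 // !mulr_ge0.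
have jn' : (j < n)%N by apply: ltnW.
have := kout_connected_ge jn' z j0 jn b10 b20 g0
  (small_component_num nL jn Lj) (many_small_num nL Lj) (large_component_num nL jn).
apply: le_trans; rewrite lerD2l lerN2.
have m0 : 0 < m%:R :> R by rewrite ltr0n expn_gt0.
have z0 : 0 < z%:R :> R by rewrite ltr0n expn_gt0.
have M0 : 0 < M%:R :> R by rewrite ltr0n expn_gt0 n0.
have x0 : 0 < (2 ^ n)%:R :> R by rewrite ltr0n expn_gt0.
have B0 : 0 < B by rewrite ltr0n expn_gt0.
have e1 : \sum_(1 <= s < m.+1) A1 s * (A1 s * (n%:R * m%:R))^-1 = n%:R^-1.
  transitivity (\sum_(1 <= s < m.+1) (n%:R * m%:R)^-1 : R).
    apply: eq_bigr => s _; have A10 : A1 s != 0.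
      by rewrite pnatr_eq0 -lt0n !muln_gt0 !expn_gt0 n0.
    by rewrite invfM mulrA divff // mul1r.
  rewrite sumr_const_nat subSS subn0 -[LHS]mulr_natl invfM mulrCA divff ?mulr1 //.
  by rewrite gt_eqF.
have e2 : (\sum_(1 <= s < M.+1) A2 s * (n%:R * M%:R * A2 s / z%:R)^-1) / z.+1%:R <= n%:R^-1.
  have -> : \sum_(1 <= s < M.+1) A2 s * (n%:R * M%:R * A2 s / z%:R)^-1 = z%:R / n%:R.
    transitivity (\sum_(1 <= s < M.+1) (z%:R / n%:R / M%:R) : R).
      rewrite big_nat [RHS]big_nat; apply: eq_bigr => s /andP[s0 _].
      have A20 : A2 s != 0 by rewrite pnatr_eq0 -lt0n !muln_gt0 !expn_gt0 n0.
      move: (A2 s) (z%:R : R) (M%:R : R) (n%:R : R) A20 z0 M0 N0 => a b c d a0 b0 c0 d0.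
      by field; rewrite a0 !gt_eqF.
    rewrite sumr_const_nat subSS subn0 -[LHS]mulr_natl mulrC divfK //.
    by rewrite gt_eqF.
  by rewrite ler_pdivrMr // mulrC ler_pM2l ?invr_gt0 // ler_nat leqnSn.
have e3 : B * \sum_(m.+1 <= s < (2 ^ n).+1) A3 s * (n%:R * (2 ^ n)%:R * B * A3 s)^-1 <= n%:R^-1.
  have -> : \sum_(m.+1 <= s < (2 ^ n).+1) A3 s * (n%:R * (2 ^ n)%:R * B * A3 s)^-1 =
      (n%:R * (2 ^ n)%:R * B)^-1 *+ (2 ^ n - m).
    rewrite -subSS -sumr_const_nat; apply: eq_bigr => s _.
    have A30 : A3 s != 0 by rewrite pnatr_eq0 -lt0n muln_gt0 !expn_gt0.
    by rewrite [X in _ / X]mulrC invfM mulrA divff // mul1r.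
  rewrite -[X in B * X]mulr_natl invfM [B * _]mulrC -!mulrA mulVf ?gt_eqF // mulr1.
  rewrite invfM mulrCA ger_pMr ?invr_gt0 // ler_pdivrMr // mul1r ler_nat.
  exact: leq_subr.
have -> : 3 * n%:R^-1 = n%:R^-1 + n%:R^-1 + n%:R^-1 :> R by ring.
by apply: lerD; [apply: lerD; rewrite // e1 | ].
Qed.

Lemma whp_inverse_rate (R : realType) (p : nat -> R) :
  (\forall n \near \oo%classic, 1 - 3 * n%:R^-1 <= p n <= 1) -> whp p.
Proof.
move=> h; apply/cvgrPdist_le => e e0.
have h3 := nbhs_infty_ger (3 / e); have h0 := nbhs_infty_gt 0.
near=> n; have /andP[l u] : 1 - 3 * n%:R^-1 <= p n <= 1 by near: n.
have n0 : 0 < n%:R :> R by rewrite ltr0n; near: n.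
have : 3 / e <= n%:R by near: n.
rewrite ler_pdivrMr // => he.
rewrite ger0_norm ?subr_ge0 //; apply: (@le_trans _ _ (3 * n%:R^-1)); first by lra.
by rewrite ler_pdivrMr // mulrC.
Unshelve. all: by end_near. Qed.

Theorem theorem1p3 (R : realType) (k : nat -> nat)
    (hk : forall n : nat, (2 <= n)%N -> (1 <= k n <= n - 1)%N) :
  ((\forall n \near \oo%classic, (k n)%:Z <= Num.floor (k0 R n)) ->
    whp (fun n : nat => kout_prob R n (k n) (fun E => ~~ gconnected E)))
  /\
  ((\forall n \near \oo%classic, Num.ceil (k0 R n) + 1 <= (k n)%:Z) ->
    whp (fun n : nat => kout_prob R n (k n) (fun E => kconnected E (k n)))).
Proof.
have kn n : (2 <= n)%N -> (0 < k n < n)%N.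
  by move=> n2; have := hk n n2; move: n2; lia.
split=> h; apply: whp_inverse_rate.
  near=> n.
  have n2 : (2 <= n)%N by near: n; exact: nbhs_infty_ge.
  have /andP[k1 k2] := kn n n2.
  have nL : large R n by near: n; exact: large_near.
  have fl : (k n)%:Z <= Num.floor (k0 R n) by near: n.
  rewrite kout_prob_le1 ?(ltnW k2) // andbT.
  apply: le_trans (disconnected_prob_ge nL k1 k2 _); last first.
    by move: fl; rewrite floor_ge_int.
  have Ni : 0 <= n%:R^-1 :> R by rewrite invr_ge0.
  by lra.
near=> n.
have n2 : (2 <= n)%N by near: n; exact: nbhs_infty_ge.
have /andP[k1 k2] := kn n n2.
have nL : large R n by near: n; exact: large_near.
have fl : Num.ceil (k0 R n) + 1 <= (k n)%:Z by near: n.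
rewrite kout_prob_le1 ?(ltnW k2) // andbT.
(* With [k n] written as [j.+1], the added 1 in the hypothesis leaves [k0 <= j], so already the
   first [j] choices reach the threshold. *)
move: k2 fl; rewrite -(prednK k1) => k2 fl; apply: connected_prob_ge => //.
apply: le_trans (ceil_ge _) _.
have : Num.ceil (k0 R n) <= ((k n).-1)%:Z by lia.
by rewrite -(ler_int R).
Unshelve. all: by end_near. Qed.
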